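(* Let $\mathbb{F}$ be a field and let $V=\mathbb{F}^2\otimes\mathbb{F}^3\otimes\mathbb{F}^3$. Let $G$ be the setwise stabiliser in $\mathrm{GL}(V)$ of the set of fundamental (rank one) tensors of $V$, and let $H$ be the subgroup of $G$ induced by $\mathrm{GL}(\mathbb{F}^2)\times\mathrm{GL}(\mathbb{F}^3)\times\mathrm{GL}(\mathbb{F}^3)$. (1) If $\mathbb{F}$ is a finite field, then there are precisely $21$ $H$-orbits and precisely $18$ $G$-orbits of tensors in $V$. (2) If $\mathbb{F}$ is an algebraically closed field, then there are precisely $18$ $H$-orbits and precisely $15$ $G$-orbits of tensors in $V$. (3) If $\mathbb{F}=\mathbb{R}$, then there are precisely $20$ $H$-orbits and precisely $17$ $G$-orbits of tensors in $V$.
   Context: All tensor products are over $\mathbb{F}$. The fundamental tensors (rank one tensors) of $V=V_1\otimes V_2\otimes V_3$ are the tensors $v_1\otimes v_2\otimes v_3$ with each $v_i\in V_i\setminus\{0\}$. The group $\mathrm{GL}(V_1)\times\mathrm{GL}(V_2)\times\mathrm{GL}(V_3)$ acts linearly on $V$ by $(g_1,g_2,g_3): v_1\otimes v_2\otimes v_3\mapsto v_1^{g_1}\otimes v_2^{g_2}\otimes v_3^{g_3}$, and $H$ denotes the resulting subgroup of $\mathrm{GL}(V)$. The orbits counted are the orbits on all elements of $V$; the orbit $\{0\}$ of the zero tensor is included in the count. *)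

(* Defs.v *)
From HB Require Import structures.
From mathcomp Require Import all_boot all_order all_algebra.
From mathcomp Require Import mathcomp_extra boolp classical_sets functions cardinality.
From mathcomp Require Import reals.

Set Implicit Arguments.
Unset Strict Implicit.
Unset Printing Implicit Defensive.

Import Order.TTheory GRing.Theory Num.Theory.
Local Open Scope classical_set_scope.
Local Open Scope ring_scope.

(* F^a ⊗ F^b ⊗ F^c in coordinates: T (i, j, k) is the coefficient of T on the
   basis tensor e_i ⊗ e_j ⊗ e_k. F^n is the space of row vectors 'rV[F]_n. *)
Definition tensor (F : fieldType) (a b c : nat) :=
  {ffun 'I_a * 'I_b * 'I_c -> F^o}.

Section Tensors.
Variables (F : fieldType) (a b c : nat).
Local Notation V := (tensor F a b c).

Definition tens (v1 : 'rV[F]_a) (v2 : 'rV[F]_b) (v3 : 'rV[F]_c) : V :=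
  [ffun p => v1 ord0 p.1.1 * v2 ord0 p.1.2 * v3 ord0 p.2].

Definition fundamental : set V :=
  [set t | exists v1 v2 v3,
     [/\ v1 != 0, v2 != 0, v3 != 0 & t = tens v1 v2 v3]].

Definition GLV : set 'End(V) := [set g | lker g == 0%VS].

Definition stabG : set 'End(V) :=
  [set g | GLV g /\ [set g t | t in fundamental] = fundamental].

(* Matrices act on row vectors from the right, so v *m g is v^g. The tensors
   v1 ⊗ v2 ⊗ v3 span V, so the triple (g1, g2, g3) determines h. *)
Definition inducedH : set 'End(V) :=
  [set h | GLV h /\
     exists (g1 : 'M[F]_a) (g2 : 'M[F]_b) (g3 : 'M[F]_c),
     [/\ g1 \in unitmx, g2 \in unitmx, g3 \in unitmx &
         forall v1 v2 v3,
           h (tens v1 v2 v3) = tens (v1 *m g1) (v2 *m g2) (v3 *m g3)]].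

Definition tensor_orbit (A : set 'End(V)) (t : V) : set V :=
  [set g t | g in A].

Definition tensor_orbits (A : set 'End(V)) : set (set V) :=
  range (tensor_orbit A).

Lemma tens_unit_fundamental g1 g2 g3 v1 v2 v3 :
    g1 \in unitmx -> g2 \in unitmx -> g3 \in unitmx ->
    v1 != 0 -> v2 != 0 -> v3 != 0 ->
  fundamental (tens (v1 *m g1) (v2 *m g2) (v3 *m g3)).
Proof.
have nz n (v : 'rV[F]_n) g : g \in unitmx -> v != 0 -> v *m g != 0.
  by move=> ug; apply: contra_neq => vg0; rewrite -[v](mulmxK ug) vg0 mul0mx.
by move=> *; exists (v1 *m g1), (v2 *m g2), (v3 *m g3); split=> //; apply: nz.
Qed.

Lemma inducedH_sub_stabG : inducedH `<=` stabG.
Proof.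
move=> h [GLh [g1 [g2 [g3 [u1 u2 u3 hE]]]]]; split=> //.
apply/seteqP; split=> t.
  case=> s [v1 [v2 [v3 [n1 n2 n3 ->]]]] <-.
  by rewrite hE; exact: tens_unit_fundamental.
case=> [v1 [v2 [v3 [n1 n2 n3 ->]]]].
exists (tens (v1 *m invmx g1) (v2 *m invmx g2) (v3 *m invmx g3)).
  by apply: tens_unit_fundamental; rewrite ?unitmx_inv.
by rewrite hE !mulmxKV.
Qed.

End Tensors.

(* Main.v *)
Require Import Defs.
From HB Require Import structures.
From mathcomp Require Import all_boot all_order all_algebra all_field.
From mathcomp Require Import mathcomp_extra boolp classical_sets functions cardinality.
From mathcomp Require Import reals.
From mathcomp Require Import ring lra.

Set Implicit Arguments.
Unset Strict Implicit.
Unset Printing Implicit Defensive.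

Import Order.TTheory GRing.Theory Num.Theory.
Local Open Scope ring_scope.

(** A tensor is the pencil xA + yB of its two 3x3 slices, and its H-orbit is the
    class of the pencil under (A, B) |-> (P (aA + bB) Q, P (cA + dB) Q).

    Normalising a combination of least nonzero rank to diag(1,0,0), diag(1,1,0)
    or the identity leaves, over any field, 18 explicit pencils and three families
    attached to a binary quadratic or cubic form without zeros.  Over an
    algebraically closed field these families are empty; over a real closed field
    the two quadratic families are single orbits and the cubic one is empty; over a
    finite field all three are single orbits, because the extensions of degree 2
    and 3 are unique and any two generators of one of them differ by a Moebius
    transformation.  The ranks occurring in the pencil, the ranks of its
    flattenings and a condition on kernels separate the orbits.

    Two fundamental tensors with fundamental sum share two of their factors up to
    scalars.  Hence an injective linear map preserving fundamental tensors is, up to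
    exchanging the two factors of dimension 3, induced by a triple of matrices.  So
    G only adds the transposition of pencils, which exchanges three pairs of orbits. *)

(** * Pencils of 3x3 matrices *)

(** The field may be as small as F_2, whose projective line has three points. The pencil diag(y, x +
    y, x) then has no invertible member, although its determinant is not the zero polynomial. An
    invertible member is therefore no possible starting point in general: the normal forms grow from
    a member of least nonzero rank, and the invariants are existence statements about members over
    [F] itself, tested in an order that stays correct over F_2. One numbering of the classes serves
    all fields. The classes whose existence depends on the field come last, as 18, 19 and 20, so the
    counts 18, 20 and 21 are lengths of initial segments of the same list. The classes exchanged by
    transposition, 4, 5, 6 and 7, 8, 9, occur over every field, which is why G always has exactly
    three orbits fewer. For the stabiliser the unequal dimensions matter: a factor of dimension 3
    cannot be sent injectively into the factor of dimension 2, so the exchange of the last two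
    factors is the only permutation left. *)

Section Matrices3.
Variable F : fieldType.
Implicit Types (M N P Q : 'M[F]_3).

(** Naming all nine entries turns a matrix identity into nine scalar identities, which [m3E] exposes
    and [ring] or [field] settles. *)
Definition m3 (a b c d e f g h i : F) : 'M[F]_3 :=
  \matrix_(r, s) nth 0 (nth [::] [:: [:: a; b; c]; [:: d; e; f]; [:: g; h; i]] r) s.

Variant m3_spec M : Type :=
  M3Spec a b c d e f g h i of M = m3 a b c d e f g h i.

Lemma m3P M : m3_spec M.
Proof.
pose o2 : 'I_3 := @Ordinal 3 2 isT.
apply: (@M3Spec M (M ord0 ord0) (M ord0 1) (M ord0 o2) (M 1 ord0) (M 1 1) (M 1 o2)
   (M o2 ord0) (M o2 1) (M o2 o2)).
by apply/matrixP => -[[|[|[|?]]] ?] // -[[|[|[|?]]] ?] //; rewrite !mxE /=;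
  congr (M _ _); apply: val_inj.
Qed.

Lemma m3_mul a b c d e f g h i a' b' c' d' e' f' g' h' i' :
  m3 a b c d e f g h i *m m3 a' b' c' d' e' f' g' h' i' =
  m3 (a * a' + b * d' + c * g') (a * b' + b * e' + c * h') (a * c' + b * f' + c * i')
     (d * a' + e * d' + f * g') (d * b' + e * e' + f * h') (d * c' + e * f' + f * i')
     (g * a' + h * d' + i * g') (g * b' + h * e' + i * h') (g * c' + h * f' + i * i').
Proof.
apply/matrixP => r s; rewrite !mxE !big_ord_recl big_ord0 !mxE addr0 addrA.
by case: r s => -[|[|[|?]]] ? // [[|[|[|?]]] ?].
Qed.

Lemma m3_add a b c d e f g h i a' b' c' d' e' f' g' h' i' :
  m3 a b c d e f g h i + m3 a' b' c' d' e' f' g' h' i' =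
  m3 (a + a') (b + b') (c + c') (d + d') (e + e') (f + f') (g + g') (h + h') (i + i').
Proof.
by apply/matrixP => -[[|[|[|?]]] ?] // [[|[|[|?]]] ?] //; rewrite !mxE.
Qed.

Lemma m3_scale x a b c d e f g h i :
  x *: m3 a b c d e f g h i =
  m3 (x * a) (x * b) (x * c) (x * d) (x * e) (x * f) (x * g) (x * h) (x * i).
Proof.
by apply/matrixP => -[[|[|[|?]]] ?] // [[|[|[|?]]] ?] //; rewrite !mxE.
Qed.

Lemma m3_tr a b c d e f g h i : (m3 a b c d e f g h i)^T = m3 a d g b e h c f i.
Proof.
by apply/matrixP => -[[|[|[|?]]] ?] // [[|[|[|?]]] ?] //; rewrite !mxE.
Qed.

Lemma m3_1 : 1%:M = m3 1 0 0 0 1 0 0 0 1.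
Proof.
by apply/matrixP => -[[|[|[|?]]] ?] // [[|[|[|?]]] ?] //; rewrite !mxE.
Qed.

Lemma m3_0 : 0 = m3 0 0 0 0 0 0 0 0 0.
Proof.
by apply/matrixP => -[[|[|[|?]]] ?] // [[|[|[|?]]] ?] //; rewrite !mxE.
Qed.

Lemma m3_inj a b c d e f g h i a' b' c' d' e' f' g' h' i' :
  m3 a b c d e f g h i = m3 a' b' c' d' e' f' g' h' i' ->
  [/\ a = a', b = b' & c = c'] /\
  [/\ d = d', e = e' & f = f'] /\ [/\ g = g', h = h' & i = i'].
Proof.
move=> /matrixP E; pose o2 : 'I_3 := @Ordinal 3 2 isT.
by split; [|split]; split;
  [move: (E ord0 ord0) | move: (E ord0 1) | move: (E ord0 o2)
  |move: (E 1 ord0) | move: (E 1 1) | move: (E 1 o2)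
  |move: (E o2 ord0) | move: (E o2 1) | move: (E o2 o2)]; rewrite !mxE.
Qed.

Lemma m3_det a b c d e f g h i :
  \det (m3 a b c d e f g h i) =
    a * (e * i - f * h) - b * (d * i - f * g) + c * (d * h - e * g).
Proof.
rewrite (expand_det_row _ ord0) !big_ord_recl big_ord0 !mxE /= addr0.
rewrite /cofactor !(expand_det_row _ ord0) !big_ord_recl !big_ord0 !mxE /=.
rewrite /cofactor !det_mx11 !mxE /=; ring.
Qed.

Definition m3E := (m3_mul, m3_add, m3_scale, m3_tr, m3_1, m3_0).

Definition rank1_minors M := forall i j k l, M i j * M k l = M i l * M k j.

(** If the minors vanish, any nonzero entry is a pivot: [M] is the product of its column and its row
    through that entry, divided by the entry. *)
Lemma rank_le1P M : reflect (rank1_minors M) (\rank M <= 1)%N.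
Proof.
apply: (iffP idP) => [rM i j k l|mM].
  have [r0|r1] : \rank M = 0%N \/ \rank M = 1%N by case: (\rank M) rM => [|[|?]]; auto.
    by move/eqP: r0; rewrite mxrank_eq0 => /eqP ->; rewrite !mxE !mul0r.
  rewrite -(mulmx_base M); move: (col_base M) (row_base M); rewrite r1 => C R.
  by rewrite !mxE !big_ord1; ring.
have [->|/eqP nz] := eqVneq M 0; first by rewrite mxrank0.
have [[i j] /= nzij] : exists p, M p.1 p.2 != 0.
  apply: contrapT => H; apply: nz; apply/matrixP => i j; rewrite mxE.
  by apply: contrapT => /eqP Hij; apply: H; exists (i, j).
rewrite (_ : M = (M i j)^-1 *: (col j M *m row i M)).
  by rewrite (leq_trans (mxrank_scale _ _)) // (leq_trans (mxrankM_maxl _ _)) // rank_leq_col.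
apply/matrixP => k l; rewrite !mxE big_ord1 !mxE (mM k j i l).
by rewrite mulrC mulfK.
Qed.

Lemma rank3P M : (\rank M == 3%N) = (\det M != 0).
Proof. by rewrite -[_ == _]/(row_free M) row_free_unit unitmxE unitfE. Qed.

End Matrices3.

(** * Equivalence of pencils and the numerical invariant *)

Section Pencils.
Variable F : fieldType.
Implicit Types (A B M P Q : 'M[F]_3).

Definition pencil := ('M[F]_3 * 'M[F]_3)%type.
Implicit Types p q r : pencil.

Definition comb p (x y : F) : 'M[F]_3 := x *: p.1 + y *: p.2.

Definition peq p q := exists a b c d P Q,
  [/\ a * d - b * c != 0, P \in unitmx, Q \in unitmx &
      q = (P *m comb p a b *m Q, P *m comb p c d *m Q)].

Lemma comb_peq p P Q a b c d x y :
  comb (P *m comb p a b *m Q, P *m comb p c d *m Q) x y =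
  P *m comb p (x * a + y * c) (x * b + y * d) *m Q.
Proof.
rewrite /comb /= !mulmxDr !mulmxDl -!scalemxAr -!scalemxAl.
by rewrite !scalerDr !scalerA !scalerDl addrACA.
Qed.

Lemma comb10 p : comb p 1 0 = p.1.
Proof. by rewrite /comb scale1r scale0r addr0. Qed.

Lemma comb01 p : comb p 0 1 = p.2.
Proof. by rewrite /comb scale1r scale0r add0r. Qed.

Lemma peq_refl p : peq p p.
Proof.
exists 1, 0, 0, 1, 1%:M, 1%:M.
rewrite !mul1r !mul0r subr0 oner_eq0 !unitmx1; split => //.
by rewrite comb10 comb01 !mul1mx !mulmx1; case: p.
Qed.

Lemma peq_sym p q : peq p q -> peq q p.
Proof.
move=> [a [b [c [d [P [Q [nz uP uQ ->]]]]]]].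
set D := _ - _ in nz.
(* The inverse of the 2x2 matrix with rows (a, b) and (c, d). *)
exists (d / D), (- b / D), (- c / D), (a / D), (invmx P), (invmx Q).
rewrite !unitmx_inv; split => //.
  rewrite (_ : _ - _ = D^-1) ?invr_eq0 //.
  by rewrite /D in nz *; field.
rewrite !comb_peq !mulmxA !mulVmx // !mul1mx !mulmxK //.
rewrite [p in LHS]surjective_pairing -comb10 -comb01.
by congr (comb _ _ _, comb _ _ _); rewrite /D in nz *; field.
Qed.

Lemma peq_trans p q r : peq p q -> peq q r -> peq p r.
Proof.
move=> [a [b [c [d [P [Q [nz uP uQ ->]]]]]]].
move=> [a' [b' [c' [d' [P' [Q' [nz' uP' uQ' ->]]]]]]].
exists (a' * a + b' * c), (a' * b + b' * d), (c' * a + d' * c), (c' * b + d' * d).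
exists (P' *m P), (Q *m Q'); rewrite !unitmx_mul uP uP' uQ uQ'; split => //.
  by rewrite (_ : _ - _ = (a * d - b * c) * (a' * d' - b' * c')) ?mulf_neq0 //; ring.
by rewrite !comb_peq !mulmxA.
Qed.

Lemma peq_mul p P Q : P \in unitmx -> Q \in unitmx ->
  peq p (P *m p.1 *m Q, P *m p.2 *m Q).
Proof.
move=> uP uQ; exists 1, 0, 0, 1, P, Q.
by rewrite !mul1r !mul0r subr0 oner_eq0 comb10 comb01.
Qed.

Lemma peq_comb p a b c d : a * d - b * c != 0 -> peq p (comb p a b, comb p c d).
Proof.
move=> nz; exists a, b, c, d, 1%:M, 1%:M.
by rewrite !mul1mx !mulmx1 !unitmx1.
Qed.

Definition trp p : pencil := (p.1^T, p.2^T).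

Lemma trpK p : trp (trp p) = p.
Proof. by rewrite /trp !trmxK; case: p. Qed.

Lemma comb_trp p x y : comb (trp p) x y = (comb p x y)^T.
Proof. by rewrite /comb linearD !linearZ. Qed.

Lemma peq_trp p q : peq p q -> peq (trp p) (trp q).
Proof.
move=> [a [b [c [d [P [Q [nz uP uQ ->]]]]]]].
exists a, b, c, d, Q^T, P^T; rewrite !unitmx_tr; split => //.
by rewrite !comb_trp /trp /= !trmx_mul !mulmxA.
Qed.

Definition dependent p := exists x y, [/\ (x != 0) || (y != 0) & comb p x y = 0].
Definition has_rank k p := exists x y, \rank (comb p x y) = k.
(** The determinant condition places the two members at distinct points of the projective line, so
    that one point of rank [k] is told apart from several. *)
Definition has_rank2 k p := exists x y z t,
  [/\ x * t - y * z != 0, \rank (comb p x y) = k & \rank (comb p z t) = k].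

(* For a combination of corank one, v and w span its kernels, and the vanishing
   of v A w and v B w says that the determinant has a multiple zero there. *)
Definition degenerate_zero p := exists x y (v : 'rV[F]_3) (w : 'cV[F]_3),
  [/\ (x != 0) || (y != 0), v != 0 /\ w != 0, v *m comb p x y = 0,
      comb p x y *m w = 0 & forall s t, v *m comb p s t *m w = 0].

(** [rrank] and [crank] are the ranks of the flattenings of the tensor that single out its second
    and its third factor. *)
Definition rrank p := \rank (row_mx p.1 p.2).
Definition crank p := \rank (col_mx p.1 p.2).

(** For independent slices of full flattening ranks, [has_rank 3] is asked only after
    [degenerate_zero]: over F_2 the class 17 has no invertible member and would otherwise be
    confused with the singular pencil 16. *)
Definition idx p : nat :=
  if `[< dependent p >] then
    if `[< has_rank 3 p >] then 3
    else if `[< has_rank 2 p >] then 2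
    else if `[< has_rank 1 p >] then 1 else 0
  else match rrank p, crank p with
  | 1, 2 => 4
  | 2, 1 => 7
  | 2, 3 => if `[< has_rank 1 p >] then 5 else 6
  | 3, 2 => if `[< has_rank 1 p >] then 8 else 9
  | 2, 2 => if `[< has_rank 1 p >] then if `[< has_rank2 1 p >] then 10 else 11
            else 18
  | _, _ =>
    if `[< has_rank 1 p >] then if `[< has_rank 2 p >] then 12 else 13
    else if `[< has_rank 2 p >] then
      if `[< degenerate_zero p >] then
        if `[< has_rank 3 p >] then if `[< has_rank2 2 p >] then 14 else 15
        else 16
      else if `[< has_rank2 2 p >] then 17 else 19
    else 20
  end.

Lemma rank_mulUU P M Q : P \in unitmx -> Q \in unitmx ->
  \rank (P *m M *m Q) = \rank M.
Proof.
move=> uP uQ; rewrite mxrankMfree ?row_free_unit //.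
by rewrite -mxrank_tr trmx_mul mxrankMfree ?mxrank_tr // row_free_unit unitmx_tr.
Qed.

(** With the members of [p] written through those of [q], a witness (x, y) for [p] yields an
    explicit witness for [q]; this is the form in which invariance is proved below. *)
Lemma peq_combE p q : peq p q -> exists a b c d P Q,
  [/\ a * d - b * c != 0, P \in unitmx, Q \in unitmx &
    forall x y, comb p x y = P *m comb q (x * a + y * c) (x * b + y * d) *m Q].
Proof.
move/peq_sym=> [a [b [c [d [P [Q [nz uP uQ ->]]]]]]].
exists a, b, c, d, P, Q; split => // x y; exact: comb_peq.
Qed.

Lemma lin2_neq0 (a b c d x y : F) : a * d - b * c != 0 ->
  (x != 0) || (y != 0) -> (x * a + y * c != 0) || (x * b + y * d != 0).
Proof.
move=> nz; apply: contraTT; rewrite !negb_or !negbK => /andP[/eqP e1 /eqP e2].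
have ex : x * (a * d - b * c) = 0.
  by transitivity ((x * a + y * c) * d - c * (x * b + y * d)); [ring | rewrite e1 e2; ring].
have ey : y * (a * d - b * c) = 0.
  by transitivity ((x * b + y * d) * a - b * (x * a + y * c)); [ring | rewrite e1 e2; ring].
move/eqP: ex; move/eqP: ey; rewrite !mulf_eq0 (negbTE nz) !orbF.
by move=> -> ->.
Qed.

Lemma dependent_peq p q : peq p q -> dependent p -> dependent q.
Proof.
move/peq_combE=> [a [b [c [d [P [Q [nz uP uQ E]]]]]]] [x [y [nxy xy0]]].
exists (x * a + y * c), (x * b + y * d); split; first exact: lin2_neq0.
by apply/eqP; rewrite -mxrank_eq0 -(rank_mulUU _ uP uQ) -E xy0 mxrank0.
Qed.

Lemma has_rank_peq k p q : peq p q -> has_rank k p -> has_rank k q.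
Proof.
move/peq_combE=> [a [b [c [d [P [Q [nz uP uQ E]]]]]]] [x [y rk]].
by exists (x * a + y * c), (x * b + y * d); rewrite -(rank_mulUU _ uP uQ) -E.
Qed.

Lemma has_rank2_peq k p q : peq p q -> has_rank2 k p -> has_rank2 k q.
Proof.
move/peq_combE=> [a [b [c [d [P [Q [nz uP uQ E]]]]]]] [x [y [z [t [nz' rk rk']]]]].
exists (x * a + y * c), (x * b + y * d), (z * a + t * c), (z * b + t * d).
split; try by rewrite -(rank_mulUU _ uP uQ) -E.
by rewrite (_ : _ - _ = (a * d - b * c) * (x * t - y * z)) ?mulf_neq0 //; ring.
Qed.

Lemma lin2_surj (a b c d s t : F) : a * d - b * c != 0 ->
  exists x y, x * a + y * c = s /\ x * b + y * d = t.
Proof.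
move=> nz; exists ((s * d - t * c) / (a * d - b * c)), ((t * a - s * b) / (a * d - b * c)).
by split; field.
Qed.

Lemma degenerate_zero_peq p q : peq p q -> degenerate_zero p -> degenerate_zero q.
Proof.
move/peq_combE=> [a [b [c [d [P [Q [nz uP uQ E]]]]]]].
move=> [x [y [v [w [nxy [nv nw] kv kw H]]]]].
exists (x * a + y * c), (x * b + y * d), (v *m P), (Q *m w); split.
- exact: lin2_neq0.
- split; first by apply: contra_neq nv => vP; rewrite -[v](mulmxK uP) vP mul0mx.
  by apply: contra_neq nw => vP; rewrite -[w](mulKmx uQ) vP mulmx0.
- by rewrite -[LHS](mulmxK uQ) -(mul0mx _ (invmx Q)) -kv E !mulmxA.
- by rewrite -[LHS](mulKmx uP) -(mulmx0 _ (invmx P)) -kw E !mulmxA.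
move=> s t; have [x' [y' [<- <-]]] := lin2_surj s t nz.
by rewrite -(H x' y') E !mulmxA.
Qed.

(** Mixing the slices and multiplying them by [Q] amount to a single right factor of size 6, so the
    rank cannot grow; symmetry of [peq] gives equality. *)
Lemma rrank_peq p q : peq p q -> rrank p = rrank q.
Proof.
suff le p' q' : peq p' q' -> (rrank q' <= rrank p')%N.
  by move=> pq; apply/eqP; rewrite eqn_leq !le //; apply: peq_sym.
move=> [a [b [c [d [P [Q [nz uP uQ ->]]]]]]]; rewrite /rrank /=.
have -> : row_mx (P *m comb p' a b *m Q) (P *m comb p' c d *m Q) =
  P *m row_mx p'.1 p'.2 *m block_mx (a *: Q) (c *: Q) (b *: Q) (d *: Q).
  rewrite -[RHS]mulmxA mul_row_block mul_mx_row /comb.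
  by rewrite -!scalemxAr !scalemxAl -!mulmxDl !mulmxA.
by rewrite (leq_trans (mxrankM_maxl _ _)) // mxrankM_maxr.
Qed.

Lemma rrank_trp p : rrank (trp p) = crank p.
Proof. by rewrite /rrank /crank /trp /= -tr_col_mx mxrank_tr. Qed.

Lemma crank_trp p : crank (trp p) = rrank p.
Proof. by rewrite -rrank_trp trpK. Qed.

Lemma crank_peq p q : peq p q -> crank p = crank q.
Proof. by move/peq_trp/rrank_peq; rewrite !rrank_trp. Qed.

Lemma asbool_peq (S : pencil -> Prop) p q :
  (forall p q, peq p q -> S p -> S q) -> peq p q -> `[< S p >] = `[< S q >].
Proof.
by move=> SP pq; apply/asboolP/asboolP; apply: SP => //; apply: peq_sym.
Qed.

Lemma idx_peq p q : peq p q -> idx p = idx q.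
Proof.
move=> pq; rewrite /idx (rrank_peq pq) (crank_peq pq).
rewrite (asbool_peq dependent_peq pq) (asbool_peq degenerate_zero_peq pq).
rewrite !(asbool_peq (@has_rank_peq _) pq).
by rewrite !(asbool_peq (@has_rank2_peq _) pq).
Qed.

Lemma asbool_trp (S : pencil -> Prop) p :
  (forall p, S p -> S (trp p)) -> `[< S (trp p) >] = `[< S p >].
Proof.
by move=> SP; apply/asboolP/asboolP => [/SP|/SP//]; rewrite trpK.
Qed.

Lemma dependent_trp p : dependent p -> dependent (trp p).
Proof. by move=> [x [y [nz E]]]; exists x, y; rewrite comb_trp E trmx0. Qed.

Lemma has_rank_trp k p : has_rank k p -> has_rank k (trp p).
Proof. by move=> [x [y E]]; exists x, y; rewrite comb_trp mxrank_tr. Qed.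

Lemma has_rank2_trp k p : has_rank2 k p -> has_rank2 k (trp p).
Proof.
by move=> [x [y [z [t [nz E E']]]]]; exists x, y, z, t; rewrite !comb_trp !mxrank_tr.
Qed.

Lemma degenerate_zero_trp p : degenerate_zero p -> degenerate_zero (trp p).
Proof.
move=> [x [y [v [w [nxy [nv nw] kv kw H]]]]]; exists x, y, w^T, v^T; split => //.
- by split; rewrite -trmx0 (inj_eq trmx_inj).
- by rewrite comb_trp -trmx_mul kw trmx0.
- by rewrite comb_trp -trmx_mul kv trmx0.
by move=> s t; rewrite comb_trp -mulmxA -!trmx_mul H trmx0.
Qed.

(** The default value of [nth] is [i] itself, so every index from 10 on is fixed. *)
Definition swap_idx i := nth i [:: 0; 1; 2; 3; 7; 8; 9; 4; 5; 6] i.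

Ltac case_asbool := repeat match goal with |- context [asbool ?S] => case: (asbool S) end.

Lemma idx_trp p : idx (trp p) = swap_idx (idx p).
Proof.
rewrite /idx rrank_trp crank_trp (asbool_trp _ dependent_trp).
rewrite (asbool_trp _ degenerate_zero_trp) !(asbool_trp _ (@has_rank_trp _)).
rewrite !(asbool_trp _ (@has_rank2_trp _)).
(* [d] is the catch-all branch of [idx]. Its values are at least 12, hence fixed by [swap_idx]. *)
set d := (X in match _ with 0 => X | _ => _ end).
have sd : d = swap_idx d.
  by rewrite /d; case_asbool.
case: (asbool (dependent p)); first by case_asbool.
by case: (rrank p) (crank p) => [|[|[|[|r]]]] [|[|[|[|s]]]] //; case_asbool.
Qed.

End Pencils.

(** * The representatives and the value of the invariant on each *)

Section Representatives.
Variable F : fieldType.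
Implicit Types (M : 'M[F]_3) (p : pencil F).

(** Turns a rank into boolean tests on minors, which rewriting evaluates as soon as the entries are
    explicit. *)
Lemma m3_rank (a b c d e f g h i : F) : \rank (m3 a b c d e f g h i) =
  if [&& a == 0, b == 0, c == 0, d == 0, e == 0, f == 0, g == 0, h == 0 & i == 0]
  then 0%N
  else if [&& a * e - b * d == 0, a * f - c * d == 0, b * f - c * e == 0,
     a * h - b * g == 0, a * i - c * g == 0, b * i - c * h == 0,
     d * h - e * g == 0, d * i - f * g == 0 & e * i - f * h == 0] then 1%N
  else if a * (e * i - f * h) - b * (d * i - f * g) + c * (d * h - e * g) == 0
  then 2 else 3.
Proof.
case: ifP => [|/negP nz].
  do 8 case/andP => /eqP ->; move/eqP ->; rewrite -m3_0; exact: mxrank0.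
case: ifP => [mi|nmi].
  apply/eqP; rewrite eqn_leq; apply/andP; split; last first.
    rewrite lt0n mxrank_eq0; apply: contra_notN nz => /eqP.
    by rewrite m3_0 => /m3_inj[[-> -> ->] [[-> -> ->] [-> -> ->]]]; rewrite eqxx.
  move: mi; do 8 case/andP => /eqP/subr0_eq ?; move=> /eqP/subr0_eq ?.
  apply/rank_le1P => -[[|[|[|?]]] ?] // -[[|[|[|?]]] ?] // -[[|[|[|?]]] ?] // -[[|[|[|?]]] ?] //;
    rewrite !mxE //=; by [|rewrite mulrC|rewrite mulrC [RHS]mulrC].
have gt1 : (1 < \rank (m3 a b c d e f g h i))%N.
  rewrite ltnNge; apply/negP => /rank_le1P H.
  pose o2 : 'I_3 := @Ordinal 3 2 isT; move/negP: nmi; apply.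
  have := H ord0 ord0 1 1; have := H ord0 ord0 1 o2; have := H ord0 1 1 o2.
  have := H ord0 ord0 o2 1; have := H ord0 ord0 o2 o2; have := H ord0 1 o2 o2.
  have := H 1 ord0 o2 1; have := H 1 ord0 o2 o2; have := H 1 1 o2 o2.
  by rewrite !mxE /=; do 9 move=> ->; rewrite !subrr eqxx.
have := rank3P (m3 a b c d e f g h i); rewrite m3_det.
have : (\rank (m3 a b c d e f g h i) <= 3)%N := rank_leq_row _.
by case: ifP => _; case: (\rank _) gt1 => [|[|[|[|]]]].
Qed.

Definition simp0 := (mul0r, mulr0, mul1r, mulr1, addr0, add0r, subr0, sub0r, oppr0).

Definition r3 (a b c : F) : 'rV[F]_3 := \row_j nth 0 [:: a; b; c] j.
Definition c3 (a b c : F) : 'cV[F]_3 := \col_j nth 0 [:: a; b; c] j.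

Variant r3_spec (v : 'rV[F]_3) : Type := R3Spec a b c of v = r3 a b c.
Variant c3_spec (v : 'cV[F]_3) : Type := C3Spec a b c of v = c3 a b c.

Lemma r3P v : r3_spec v.
Proof.
pose o2 : 'I_3 := @Ordinal 3 2 isT; exists (v 0 ord0) (v 0 1) (v 0 o2).
by apply/rowP => -[[|[|[|?]]] ?] //; rewrite !mxE /=; congr (v _ _); apply: val_inj.
Qed.

Lemma c3P v : c3_spec v.
Proof.
pose o2 : 'I_3 := @Ordinal 3 2 isT; exists (v ord0 0) (v 1 0) (v o2 0).
by apply/colP => -[[|[|[|?]]] ?] //; rewrite !mxE /=; congr (v _ _); apply: val_inj.
Qed.

Lemma r3_mul x y z (a b c d e f g h i : F) :
  r3 x y z *m m3 a b c d e f g h i =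
  r3 (x * a + y * d + z * g) (x * b + y * e + z * h) (x * c + y * f + z * i).
Proof.
apply/rowP => -[[|[|[|?]]] ?] //; by rewrite !mxE !big_ord_recl big_ord0 !mxE /= addr0 addrA.
Qed.

Lemma c3_mul x y z (a b c d e f g h i : F) :
  m3 a b c d e f g h i *m c3 x y z =
  c3 (a * x + b * y + c * z) (d * x + e * y + f * z) (g * x + h * y + i * z).
Proof.
apply/colP => -[[|[|[|?]]] ?] //; by rewrite !mxE !big_ord_recl big_ord0 !mxE /= addr0 addrA.
Qed.

Lemma r3_eq0 x y z : (r3 x y z == 0) = [&& x == 0, y == 0 & z == 0].
Proof.
pose o2 : 'I_3 := @Ordinal 3 2 isT.
apply/eqP/and3P => [/rowP E|[/eqP -> /eqP -> /eqP ->]].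
  by have := E ord0; have := E 1; have := E o2; rewrite !mxE /= => -> -> ->.
by apply/rowP => -[[|[|[|?]]] ?] //; rewrite !mxE.
Qed.

Lemma c3_eq0 x y z : (c3 x y z == 0) = [&& x == 0, y == 0 & z == 0].
Proof.
pose o2 : 'I_3 := @Ordinal 3 2 isT.
apply/eqP/and3P => [/colP E|[/eqP -> /eqP -> /eqP ->]].
  by have := E ord0; have := E 1; have := E o2; rewrite !mxE /= => -> -> ->.
by apply/colP => -[[|[|[|?]]] ?] //; rewrite !mxE.
Qed.

Lemma r3c3_eq0 x y z x' y' z' :
  (r3 x y z *m c3 x' y' z' == 0) = (x * x' + y * y' + z * z' == 0).
Proof.
apply/eqP/eqP => [/matrixP/(_ 0 0)|E].
  by rewrite !mxE !big_ord_recl big_ord0 !mxE /= addr0 addrA.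
by apply/matrixP => i j; rewrite !mxE !big_ord_recl big_ord0 !mxE /= addr0 addrA.
Qed.

(** [D] fixes both slices from the left and is itself a right combination of them, so it has the
    column space of the flattening. Products of 3x3 matrices thus replace elimination on a 3x6
    matrix. *)
Lemma rrankE p D S1 S2 : D *m p.1 = p.1 -> D *m p.2 = p.2 ->
  p.1 *m S1 + p.2 *m S2 = D -> rrank p = \rank D.
Proof.
move=> D1 D2 SD; apply/eqP; rewrite eqn_leq /rrank; apply/andP; split.
  by rewrite -D1 -D2 -mul_mx_row mxrankM_maxl.
by rewrite -SD -mul_row_col mxrankM_maxl.
Qed.

Lemma crankE p D S1 S2 : p.1 *m D = p.1 -> p.2 *m D = p.2 ->
  S1 *m p.1 + S2 *m p.2 = D -> crank p = \rank D.
Proof.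
move=> D1 D2 SD; apply/eqP; rewrite eqn_leq /crank; apply/andP; split.
  by rewrite -D1 -D2 -mul_col_mx mxrankM_maxr.
by rewrite -SD -mul_row_col mxrankM_maxr.
Qed.

Definition diag1 : 'M[F]_3 := m3 1 0 0 0 0 0 0 0 0.
Definition diag2 : 'M[F]_3 := m3 1 0 0 0 1 0 0 0 0.

(* 0-3: dependent slices.  4-9: exactly one Kronecker block of positive index, one of
   L_1, L_2 (4-6) or its transpose (7-9).  10, 11, 18: the regular 2x2 pencils.
   16: L_1 and its transpose.  12-15, 17, 19, 20: the regular 3x3 pencils.
   Only 18-20 depend on the parameters. *)
Definition rep (a b c d : F) M (i : nat) : pencil F := nth (M, 1%:M)
  [:: (0, 0); (diag1, 0); (diag2, 0); (1%:M, 0);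
      (m3 0 1 0 0 0 0 0 0 0, diag1);
      (m3 0 0 1 0 1 0 0 0 0, diag1);
      (m3 0 0 1 1 0 0 0 0 0, diag2);
      (m3 0 0 0 1 0 0 0 0 0, diag1);
      (m3 0 0 0 0 1 0 1 0 0, diag1);
      (m3 0 1 0 0 0 0 1 0 0, diag2);
      (m3 0 0 0 0 1 0 0 0 0, diag1);
      (m3 0 1 0 1 0 0 0 0 0, diag1);
      (m3 0 0 0 0 1 0 0 0 1, diag1);
      (m3 0 0 1 0 1 0 1 0 0, diag1);
      (m3 0 1 0 0 0 0 0 0 1, diag2);
      (m3 0 0 1 1 0 0 0 1 0, diag2);
      (m3 0 0 1 0 0 0 0 1 0, diag2);
      (m3 0 0 0 0 1 0 0 0 1, diag2);
      (m3 a b 0 c d 0 0 0 0, diag2);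
      (m3 a b 0 c d 0 0 0 1, diag2)] i.

(** The form is the determinant of [x *: M + y%:M] for the 2x2 matrix with rows (a, b) and (c,
    d). *)
Definition anisotropic2 (a b c d : F) := forall x y,
  (x * a + y) * (x * d + y) - (x * b) * (x * c) = 0 -> x = 0 /\ y = 0.
Definition anisotropic3 M := forall x y, \det (x *: M + y%:M) = 0 -> x = 0 /\ y = 0.

Lemma has_rankI k p x y : \rank (comb p x y) = k -> `[< has_rank k p >] = true.
Proof. by move=> H; apply/asboolP; exists x, y. Qed.

Lemma has_rankF k p : (forall x y, \rank (comb p x y) <> k) -> `[< has_rank k p >] = false.
Proof. by move=> H; apply/asboolPn => -[x [y]]; apply: H. Qed.

Lemma has_rank2I k p x y z t : x * t - y * z != 0 -> \rank (comb p x y) = k ->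
  \rank (comb p z t) = k -> `[< has_rank2 k p >] = true.
Proof. by move=> H1 H2 H3; apply/asboolP; exists x, y, z, t. Qed.

(** The representatives are chosen so that a unique point of rank [k] lies at x = 0, that is, at the
    second slice. *)
Lemma has_rank2F k p : (forall x y, \rank (comb p x y) = k -> x = 0) ->
  `[< has_rank2 k p >] = false.
Proof.
move=> H; apply/asboolPn => -[x [y [z [t [nz /H x0 /H z0]]]]].
by rewrite x0 z0 mul0r mulr0 subrr eqxx in nz.
Qed.

Lemma dependentF p : (forall x y, comb p x y = 0 -> x = 0 /\ y = 0) ->
  `[< dependent p >] = false.
Proof.
move=> H; apply/asboolPn => -[x [y [nz /H[x0 y0]]]].
by rewrite x0 y0 eqxx in nz.
Qed.

Lemma degenerate_zeroF p : (forall x y v1 v2 v3 w1 w2 w3, (x != 0) || (y != 0) ->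
    r3 v1 v2 v3 != 0 -> c3 w1 w2 w3 != 0 -> r3 v1 v2 v3 *m comb p x y = 0 ->
    comb p x y *m c3 w1 w2 w3 = 0 ->
    (forall s t, r3 v1 v2 v3 *m comb p s t *m c3 w1 w2 w3 = 0) -> False) ->
  `[< degenerate_zero p >] = false.
Proof.
move=> H; apply/asboolPn => -[x [y [v [w]]]].
case: (r3P v) => ? ? ? -> [nxy [nv nw] kv kw K]; move: nw kw K; case: (c3P w) => ? ? ? -> nw kw K.
by apply: (H x y) nxy nv nw kv kw K.
Qed.

Ltac expand := rewrite /comb /= /diag1 /diag2 ?m3E ?simp0.
Ltac concrete := expand; rewrite m3_rank ?simp0 ?subrr ?oppr_eq0 ?eqxx ?oner_eq0 //=.
Ltac generic := move=> x y; expand; rewrite m3_rank ?simp0;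
  have [?|/negbTE ?] := eqVneq x 0; have [?|/negbTE ?] := eqVneq y 0;
  repeat match goal with H : ?v = 0 |- _ => subst v end;
  rewrite ?simp0 ?subrr ?(oppr_eq0, mulf_eq0, mulrN, mulNr) ?eqxx;
  repeat match goal with H : (_ == _) = false |- _ => rewrite ?H; clear H end;
  rewrite ?eqxx ?orbT ?andbF //= ?andbF //=; try by do ?case: ifP => _.
Ltac hasR k x y := rewrite (@has_rankI k _ x y); last by concrete.
Ltac noR k := rewrite (@has_rankF k); last by generic.
Ltac hasR2 k x y z t := rewrite (@has_rank2I k _ x y z t);
  [ | by rewrite ?simp0 ?oner_eq0 | by concrete | by concrete].
Ltac noR2 k := rewrite (@has_rank2F k); last by generic.
Ltac degen x y v w := rewrite (_ : `[< degenerate_zero _ >] = true);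
  last by (apply/asboolP; exists x, y, v, w;
    rewrite /comb /= /diag1 /diag2 ?m3E ?r3_mul ?c3_mul ?simp0 ?r3_eq0 ?c3_eq0 ?eqxx ?oner_eq0 ?orbT ?andbF;
    split => // [||s t]; apply/eqP;
    rewrite ?r3_eq0 ?c3_eq0 ?eqxx // /comb /= ?m3E r3_mul r3c3_eq0 ?simp0 ?eqxx).
Ltac indep := rewrite dependentF; last by
  move=> x y; rewrite /comb /= /diag1 /diag2 ?m3E ?simp0 => /m3_inj[[? ? ?] [[? ? ?] [? ? ?]]].
Ltac shape D S1 S2 D' S1' S2' :=
  rewrite (@rrankE _ D S1 S2) ?(@crankE _ D' S1' S2') /= /diag1 /diag2 ?m3E ?simp0 //;
  rewrite !m3_rank ?simp0 ?oner_eq0 ?eqxx ?oppr_eq0 ?oner_eq0 //=.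

Section Reps.
Variables (a b c d : F) (M : 'M[F]_3).
Local Notation rep := (rep a b c d M).

Lemma idx_rep0 : idx (rep 0) = 0%N.
Proof.
rewrite /idx (_ : `[< dependent _ >] = true); last first.
  by apply/asboolP; exists 1, 0; rewrite oner_eq0 /comb /= !scaler0 addr0.
by rewrite !has_rankF // => x y; rewrite /comb /= !scaler0 addr0 mxrank0.
Qed.

Lemma dependent_0 (A : 'M[F]_3) : `[< dependent (A, 0) >].
Proof.
by apply/asboolP; exists 0, 1; rewrite oner_eq0 orbT /comb /= scaler0 scale0r addr0.
Qed.

Lemma idx_rep1 : idx (rep 1) = 1%N.
Proof.
rewrite /idx [rep 1]/= dependent_0.
noR 3%N. noR 2%N. by hasR 1%N (1 : F) (0 : F).
Qed.

Lemma idx_rep2 : idx (rep 2) = 2.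
Proof.
rewrite /idx [rep 2]/= dependent_0; noR 3%N; by hasR 2%N (1 : F) (0 : F).
Qed.

Lemma idx_rep3 : idx (rep 3) = 3.
Proof.
rewrite /idx [rep 3]/= dependent_0; by hasR 3%N (1 : F) (0 : F).
Qed.

Lemma idx_rep4 : idx (rep 4) = 4.
Proof.
rewrite /idx; indep.
shape diag1 (0 : 'M[F]_3) (1%:M : 'M[F]_3) diag2 (m3 0 0 0 1 0 0 0 0 0 : 'M[F]_3) diag1.
Qed.

Lemma idx_rep5 : idx (rep 5) = 5.
Proof.
rewrite /idx; indep.
shape diag2 (m3 0 0 0 0 1 0 0 0 0 : 'M[F]_3) diag1
  (1%:M : 'M[F]_3) (m3 0 0 0 0 1 0 1 0 0 : 'M[F]_3) diag1.
by hasR 1%N (0 : F) (1 : F).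
Qed.

Lemma idx_rep6 : idx (rep 6) = 6.
Proof.
rewrite /idx; indep.
shape diag2 (0 : 'M[F]_3) (1%:M : 'M[F]_3) (1%:M : 'M[F]_3) (m3 0 0 0 0 0 0 1 0 0 : 'M[F]_3)
  (1%:M : 'M[F]_3).
by noR 1%N.
Qed.

Lemma rep_trp i : (4 <= i < 7)%N -> rep (i + 3) = trp (rep i).
Proof.
by move: i => [|[|[|[|[|[|[|i]]]]]]] //= _; rewrite /trp /= /diag1 /diag2 !m3E.
Qed.

Lemma idx_rep10 : idx (rep 10) = 10.
Proof.
rewrite /idx; indep.
shape diag2 (1%:M : 'M[F]_3) (1%:M : 'M[F]_3) diag2 (1%:M : 'M[F]_3) (1%:M : 'M[F]_3).
hasR 1%N (0 : F) (1 : F).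
by hasR2 1%N (1 : F) (0 : F) (0 : F) (1 : F).
Qed.

Lemma idx_rep11 : idx (rep 11) = 11.
Proof.
rewrite /idx; indep.
shape diag2 (m3 0 1 0 0 0 0 0 0 0 : 'M[F]_3) (1%:M : 'M[F]_3)
   diag2 (m3 0 0 0 1 0 0 0 0 0 : 'M[F]_3) (1%:M : 'M[F]_3).
hasR 1%N (0 : F) (1 : F).
by noR2 1%N.
Qed.

Lemma idx_rep12 : idx (rep 12) = 12.
Proof.
rewrite /idx; indep.
shape (1%:M : 'M[F]_3) (1%:M : 'M[F]_3) (1%:M : 'M[F]_3)
  (1%:M : 'M[F]_3) (1%:M : 'M[F]_3) (1%:M : 'M[F]_3).
hasR 1%N (0 : F) (1 : F).
by hasR 2%N (1 : F) (0 : F).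
Qed.

Lemma idx_rep13 : idx (rep 13) = 13.
Proof.
rewrite /idx; indep.
shape (1%:M : 'M[F]_3) (m3 0 0 1 0 1 0 0 0 0 : 'M[F]_3) (1%:M : 'M[F]_3)
  (1%:M : 'M[F]_3) (m3 0 0 0 0 1 0 1 0 0 : 'M[F]_3) (1%:M : 'M[F]_3).
hasR 1%N (0 : F) (1 : F).
by noR 2%N.
Qed.

Lemma idx_rep14 : idx (rep 14) = 14.
Proof.
rewrite /idx; indep.
shape (1%:M : 'M[F]_3) (m3 0 0 0 0 0 0 0 0 1 : 'M[F]_3) (1%:M : 'M[F]_3)
  (1%:M : 'M[F]_3) (m3 0 0 0 0 0 0 0 0 1 : 'M[F]_3) (1%:M : 'M[F]_3).
noR 1%N.
hasR 2%N (0 : F) (1 : F).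
degen (1 : F) (0 : F) (r3 0 1 0 : 'rV[F]_3) (c3 1 0 0 : 'cV[F]_3).
hasR 3%N (1 : F) (1 : F).
by hasR2 2%N (1 : F) (0 : F) (0 : F) (1 : F).
Qed.

Lemma idx_rep15 : idx (rep 15) = 15.
Proof.
rewrite /idx; indep.
shape (1%:M : 'M[F]_3) (m3 0 0 0 0 0 1 0 0 0 : 'M[F]_3) (1%:M : 'M[F]_3)
  (1%:M : 'M[F]_3) (m3 0 0 0 0 0 0 1 0 0 : 'M[F]_3) (1%:M : 'M[F]_3).
noR 1%N.
hasR 2%N (0 : F) (1 : F).
degen (0 : F) (1 : F) (r3 0 0 1 : 'rV[F]_3) (c3 0 0 1 : 'cV[F]_3).
hasR 3%N (1 : F) (0 : F).
by noR2 2%N.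
Qed.

Lemma idx_rep16 : idx (rep 16) = 16.
Proof.
rewrite /idx; indep.
shape (1%:M : 'M[F]_3) (m3 0 0 0 0 0 1 0 0 0 : 'M[F]_3) (1%:M : 'M[F]_3)
  (1%:M : 'M[F]_3) (m3 0 0 0 0 0 0 1 0 0 : 'M[F]_3) (1%:M : 'M[F]_3).
noR 1%N.
hasR 2%N (0 : F) (1 : F).
degen (0 : F) (1 : F) (r3 0 0 1 : 'rV[F]_3) (c3 0 0 1 : 'cV[F]_3).
by noR 3%N.
Qed.

(** The members are diag(y, x + y, x). At each of the three zeros of the determinant both kernels
    are spanned by the same coordinate vector, and some slice pairs that vector with itself to 1, so
    no zero is degenerate. *)
Lemma idx_rep17 : idx (rep 17) = 17.
Proof.
rewrite /idx; indep.
shape (1%:M : 'M[F]_3) (m3 0 0 0 0 0 0 0 0 1 : 'M[F]_3) (1%:M : 'M[F]_3)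
  (1%:M : 'M[F]_3) (m3 0 0 0 0 0 0 0 0 1 : 'M[F]_3) (1%:M : 'M[F]_3).
noR 1%N.
hasR 2%N (0 : F) (1 : F).
rewrite degenerate_zeroF.
  by hasR2 2%N (1 : F) (0 : F) (0 : F) (1 : F).
move=> x y v1 v2 v3 w1 w2 w3 nxy nv nw kv kw H.
have := H 1 0; have := H 0 1; rewrite comb10 comb01 /= => /eqP H1 /eqP H2; clear H.
move: nv nw kv kw H1 H2; rewrite /comb /= /diag2 !m3E !r3_mul !c3_mul !r3c3_eq0 !simp0.
move=> nv nw /eqP kv /eqP kw H1 H2; move: nv nw kv kw H1 H2.
rewrite !r3_eq0 !c3_eq0 !mulf_eq0 => nv nw kv kw.
have [x0|nx] := eqVneq x 0.
  move: nxy nv nw kv kw; rewrite x0 eqxx simp0 /= => /negbTE -> /=.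
  rewrite !orbF !orbT !andbT => nv nw /andP[/eqP v1_0 /eqP v2_0] /andP[/eqP w1_0 /eqP w2_0].
  move: nv nw; rewrite v1_0 v2_0 w1_0 w2_0 eqxx !simp0 /= mulf_eq0.
  by do 2 move=> /negbTE ->.
move: kv kw; rewrite (negbTE nx) !orbF => /and3P[y1 y2 /eqP v3_0] /= /and3P[y1' y2' /eqP w3_0].
rewrite v3_0 w3_0 !simp0 mulf_eq0 => H1 H2.
have H3 : v2 * w2 = 0 by case/orP: H2 => /eqP ->; rewrite ?mul0r ?mulr0.
move: H1; rewrite H3 addr0 mulf_eq0 => H1.
move: nv nw y1 y2 y1' y2'; rewrite v3_0 w3_0 eqxx !andbT.
have [y0|ny] := eqVneq y 0; rewrite ?orbF.
  rewrite y0 addr0 (negbTE nx) !orbF => nv nw _ /eqP v2_0 _ /eqP w2_0.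
  by move: nv nw H1; rewrite v2_0 w2_0 eqxx !andbT => /negbTE -> /negbTE ->.
move=> nv nw /eqP v1_0 _ /eqP w1_0 _.
by move: nv nw H2; rewrite v1_0 w1_0 eqxx /= => /negbTE -> /negbTE ->.
Qed.

Hypothesis aniso2 : anisotropic2 a b c d.

Lemma anisotropic2_eq0 x y :
  ((x * a + y) * (x * d + y) - (x * b) * (x * c) == 0) = (x == 0) && (y == 0).
Proof.
apply/eqP/andP => [/aniso2[-> ->]|[/eqP -> /eqP ->]]; first by rewrite eqxx.
by rewrite !simp0.
Qed.

Lemma dependent_aniso (w : F) : `[< dependent (m3 a b 0 c d 0 0 0 w, diag2) >] = false.
Proof.
rewrite dependentF // => x y; rewrite /comb /= /diag2 ?m3E ?simp0.
case/m3_inj=> [[e1 e2 _] [[e3 e4 _] _]]; apply: aniso2.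
by rewrite e1 e2 !mul0r subrr.
Qed.

Lemma idx_rep18 : idx (rep 18) = 18.
Proof.
rewrite /idx dependent_aniso.
shape diag2 (0 : 'M[F]_3) (1%:M : 'M[F]_3) diag2 (0 : 'M[F]_3) (1%:M : 'M[F]_3).
rewrite has_rankF // => x y; expand; rewrite m3_rank anisotropic2_eq0 !simp0.
have [x0|nx] := eqVneq x 0; have [y0|ny] := eqVneq y 0 => //=; case: ifP => //; try by case: ifP.
by rewrite x0 y0 !simp0 eqxx.
Qed.

Lemma rank_rep19 x y : \rank (comb (rep 19) x y) =
  if x == 0 then if y == 0 then 0%N else 2 else 3.
Proof.
expand; rewrite m3_rank !simp0.
have [->|nx] := eqVneq x 0.
  by have [->|ny] := eqVneq y 0; rewrite !simp0 ?eqxx //= mulf_eq0 (negbTE ny) /= ?andbF.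
rewrite ?andbF /=.
have K u v : u * (v * x) - x * b * (x * c * x) = (u * v - x * b * (x * c)) * x by ring.
by rewrite K !mulf_eq0 !anisotropic2_eq0 (negbTE nx).
Qed.

(** The determinant is [x] times an anisotropic form: its only zero is x = 0, and it is simple
    there. *)
Lemma idx_rep19 : idx (rep 19) = 19.
Proof.
rewrite /idx dependent_aniso.
shape (1%:M : 'M[F]_3) (m3 0 0 0 0 0 0 0 0 1 : 'M[F]_3) (1%:M : 'M[F]_3)
  (1%:M : 'M[F]_3) (m3 0 0 0 0 0 0 0 0 1 : 'M[F]_3) (1%:M : 'M[F]_3).
rewrite has_rankF => [|x y]; last by rewrite rank_rep19; case: ifP => // _; case: ifP.
rewrite (@has_rankI 2 _ 0 1); last by rewrite rank_rep19 eqxx oner_eq0.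
rewrite has_rank2F => [|x y]; last by rewrite rank_rep19; have [|] := eqVneq x 0.
rewrite degenerate_zeroF // => x y v1 v2 v3 w1 w2 w3 nxy nv nw kv kw H.
(* A kernel vector makes the member singular, which leaves only x = 0. There both kernels are
   spanned by the third coordinate vector, on which the first slice takes the value 1. *)
have r2 : (\rank (comb (rep 19) x y) < 3)%N.
  rewrite ltn_neqAle rank_leq_row andbT rank3P negbK.
  apply/det0P; exists (r3 v1 v2 v3) => //.
move: (r2); rewrite rank_rep19; have [x0 _|//] := eqVneq x 0.
have := H 1 0; rewrite comb10 /=.
move: nxy nv nw kv kw; rewrite x0 eqxx /comb /= /diag2 ?m3E !simp0 => ny.
rewrite !r3_mul !c3_mul !simp0 => nv nw /eqP kv /eqP kw /eqP; move: nv nw kv kw.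
rewrite !r3_eq0 !c3_eq0 !r3c3_eq0 ?simp0 !mulf_eq0 (negbTE ny) !orbF /= eqxx !andbT.
move=> nv nw /andP[/eqP v10 /eqP v20] /andP[/eqP w10 /eqP w20]; move: nv nw.
by rewrite v10 v20 w10 w20 ?simp0 eqxx /= mulf_eq0 => /negbTE -> /negbTE ->.
Qed.

Hypothesis aniso3 : anisotropic3 M.

Lemma rank_rep20 x y : \rank (comb (rep 20) x y) =
  if (x == 0) && (y == 0) then 0%N else 3.
Proof.
case: ifP => [/andP[/eqP -> /eqP ->]|nxy].
  by rewrite /comb !scale0r addr0 mxrank0.
apply/eqP; rewrite rank3P /comb /= scalemx1; apply: contraFneq nxy.
by move/aniso3=> [-> ->]; rewrite eqxx.
Qed.

Lemma idx_rep20 : idx (rep 20) = 20.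
Proof.
rewrite /idx dependentF => [|x y]; last first.
  move/eqP; rewrite -mxrank_eq0 rank_rep20.
  by case: ifP => // /andP[/eqP -> /eqP ->].
rewrite (@rrankE _ 1%:M 0 1%:M) ?(@crankE _ 1%:M 0 1%:M) /= ?mul1mx ?mulmx1 ?mul0mx ?mulmx0 ?add0r //.
rewrite !mxrank1.
by rewrite !has_rankF // => x y; rewrite rank_rep20; case: ifP.
Qed.

End Reps.

Lemma idx_rep_split a b c d M i : (i < 18)%N -> idx (rep a b c d M i) = i.
Proof.
have tr j : (4 <= j < 7)%N -> idx (rep a b c d M j) = j ->
    idx (rep a b c d M (j + 3)) = swap_idx j.
  by move=> Hj E; rewrite rep_trp // idx_trp E.
move: i => [|[|[|[|[|[|[|[|[|[|[|[|[|[|[|[|[|[|i]]]]]]]]]]]]]]]]]] // _.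
- exact: idx_rep0.
- exact: idx_rep1.
- exact: idx_rep2.
- exact: idx_rep3.
- exact: idx_rep4.
- exact: idx_rep5.
- exact: idx_rep6.
- exact: (tr 4 isT (idx_rep4 _ _ _ _ _)).
- exact: (tr 5 isT (idx_rep5 _ _ _ _ _)).
- exact: (tr 6 isT (idx_rep6 _ _ _ _ _)).
- exact: idx_rep10.
- exact: idx_rep11.
- exact: idx_rep12.
- exact: idx_rep13.
- exact: idx_rep14.
- exact: idx_rep15.
- exact: idx_rep16.
- exact: idx_rep17.
Qed.

End Representatives.

Arguments diag1 {F}.
Arguments diag2 {F}.

(** * Classification over an arbitrary field *)

Lemma peq_m3 (F : fieldType) (P Q : 'M[F]_3) (x y z t : F) (A B A' B' : 'M[F]_3) : \det P != 0 -> \det Q != 0 ->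
  x * t - y * z != 0 -> P *m (x *: A + y *: B) *m Q = A' ->
  P *m (z *: A + t *: B) *m Q = B' -> peq (A, B) (A', B').
Proof.
move=> dP dQ nz <- <-; exists x, y, z, t, P, Q.
by rewrite !unitmxE !unitfE.
Qed.

Ltac m3eq := rewrite /diag1 /diag2 ?m3E; congr m3; try solve [ring | by field | by rewrite ?simp0; field].
Ltac m3det := rewrite ?det1 ?m3_det ?simp0; try apply: mulf_neq0; rewrite ?oppr_eq0 ?invr_eq0 ?oner_eq0 //.
Ltac by_peq P Q x y z t := apply: (@peq_m3 _ P Q x y z t);
  [ try by m3det | try by m3det
  | rewrite ?simp0 ?oppr_eq0 ?invr_eq0 ?oner_eq0 // | try m3eq | try m3eq].

Section Classification.
Variable F : fieldType.
Implicit Types (A B M P Q : 'M[F]_3) (p q : pencil F).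

Definition valid (a b c d : F) M (i : nat) :=
  [\/ (i < 18)%N, (i == 18) || (i == 19) /\ anisotropic2 a b c d | i = 20 /\ anisotropic3 M].

Definition classified p := exists a b c d M i, valid a b c d M i /\ peq p (rep a b c d M i).

Lemma classified_peq p q : peq p q -> classified q -> classified p.
Proof.
move=> pq [a [b [c [d [M [i [v qr]]]]]]].
by exists a, b, c, d, M, i; split => //; apply: peq_trans pq qr.
Qed.

Lemma classified_rep i p : (i < 18)%N -> p = rep 0 0 0 0 0 i -> classified p.
Proof.
by move=> i18 ->; exists 0, 0, 0, 0, 0, i; split; [apply: Or31 | apply: peq_refl].
Qed.

Ltac by_pq P Q := by_peq P Q (1 : F) (0 : F) (0 : F) (1 : F).

(** The rank normal form of the 2x2 matrix with rows (p, q) and (r, s), [k] being its rank. It is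
    spelled out in entries so that the transformations can be bordered to size 3. *)
Lemma norm2 (p q r s : F) : exists p1 p2 p3 p4 q1 q2 q3 q4 : F, exists k : nat,
  [/\ p1 * p4 - p2 * p3 != 0, q1 * q4 - q2 * q3 != 0, (k <= 2)%N &
  [/\ (p1 * p + p2 * r) * q1 + (p1 * q + p2 * s) * q3 = (0 < k)%N%:R,
      (p1 * p + p2 * r) * q2 + (p1 * q + p2 * s) * q4 = 0,
      (p3 * p + p4 * r) * q1 + (p3 * q + p4 * s) * q3 = 0 &
      (p3 * p + p4 * r) * q2 + (p3 * q + p4 * s) * q4 = (1 < k)%N%:R]].
Proof.
have [D0|nD] := eqVneq (p * s - q * r) 0; last first.
  exists (s / (p * s - q * r)), (- q / (p * s - q * r)), (- r / (p * s - q * r)),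
    (p / (p * s - q * r)), 1, 0, 0, 1, 2.
  split => //; first by rewrite (_ : _ - _ = (p * s - q * r)^-1) ?invr_eq0 //; field.
    by rewrite !simp0 oner_eq0.
  by split; rewrite /=; field.
(* The determinant vanishes, and the first nonzero entry serves as pivot. *)
have [p0|np] := eqVneq p 0; last first.
  exists p^-1, 0, (- r / p), 1, 1, (- q / p), 0, 1, 1.
  rewrite ?simp0 ?invr_eq0 ?oner_eq0; split => //; split; rewrite /=; try by field.
  have -> : s = q * r / p by apply: (mulfI np); rewrite (subr0_eq D0); field.
  by field.
have [q0|nq] := eqVneq q 0; last first.
  have r0 : r = 0.
    by move/eqP: D0; rewrite p0 !simp0 oppr_eq0 mulf_eq0 (negbTE nq) => /eqP.
  exists q^-1, 0, (- s / q), 1, 0, 1, 1, 0, 1; rewrite p0 r0.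
  rewrite ?simp0 ?oppr_eq0 ?invr_eq0 ?oner_eq0; split => //; split; rewrite /=; by field.
have [r0|nr] := eqVneq r 0; last first.
  exists 0, r^-1, 1, 0, 1, (- s / r), 0, 1, 1; rewrite p0 q0.
  rewrite ?simp0 ?oppr_eq0 ?invr_eq0 ?oner_eq0; split => //; split; rewrite /=; by field.
have [s0|ns] := eqVneq s 0; last first.
  exists 0, s^-1, 1, 0, 0, 1, 1, 0, 1; rewrite p0 q0 r0.
  rewrite ?simp0 ?oppr_eq0 ?invr_eq0 ?oner_eq0; split => //; split; rewrite /=; by field.
exists 1, 0, 0, 1, 1, 0, 0, 1, 0%N; rewrite p0 q0 r0 s0.
by rewrite !simp0 oner_eq0; split.
Qed.

Lemma det_completion (x y : F) : (x != 0) || (y != 0) ->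
  exists c d : F, c * y - d * x != 0.
Proof.
move=> nxy; have [x0|nx] := eqVneq x 0; last first.
  by exists 0, 1; rewrite !simp0 oppr_eq0.
by move: nxy; rewrite x0 eqxx /= => ny; exists 1, 0; rewrite !simp0.
Qed.

Lemma classified_dependent p : dependent p -> classified p.
Proof.
move=> [x [y [nxy E]]].
have [c [d nz]] := det_completion nxy.
apply: (classified_peq (peq_comb p nz)); rewrite E.
move: (comb p c d) => A.
have := mulmx_ebase A; set L := col_ebase A; set R := row_ebase A => EA.
have uL : L \in unitmx := col_ebase_unit A.
have uR : R \in unitmx := row_ebase_unit A.
have uL' : invmx L \in unitmx by rewrite unitmx_inv.
have uR' : invmx R \in unitmx by rewrite unitmx_inv.
apply: (classified_peq (peq_mul (A, 0) uL' uR')) => /=.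
rewrite mulmx0 mul0mx -EA !mulmxA mulVmx // mul1mx mulmxK //.
apply: (@classified_rep (\rank A)); first by rewrite (leq_ltn_trans (rank_leq_row A)).
move: (rank_leq_row A); case: (\rank A) => [|[|[|[|k]]]] //= _; congr pair;
  rewrite ?m3E /diag1 /diag2; apply/matrixP => -[[|[|[|?]]] ?] // [[|[|[|?]]] ?] //; by rewrite !mxE.
Qed.

Lemma peq_pid p x y : (x != 0) || (y != 0) ->
  exists A, peq p (A, pid_mx (\rank (comb p x y))).
Proof.
move=> nxy.
have [c [d nz]] := det_completion nxy.
have := peq_comb p nz; move: (comb p c d) (comb p x y) => A B pAB.
have uL' : invmx (col_ebase B) \in unitmx by rewrite unitmx_inv col_ebase_unit.
have uR' : invmx (row_ebase B) \in unitmx by rewrite unitmx_inv row_ebase_unit.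
have := peq_trans pAB (peq_mul (A, B) uL' uR').
rewrite /= -{4}(mulmx_ebase B) !mulmxA mulVmx ?col_ebase_unit // mul1mx.
rewrite mulmxK ?row_ebase_unit // => H; by exists (invmx (col_ebase B) *m A *m invmx (row_ebase B)).
Qed.

(** Adding a multiple of [diag1] to the first slice makes the corner entry arbitrary. *)
Lemma peq_corner (a b c d e f g h i a' : F) :
  peq (m3 a b c d e f g h i, diag1) (m3 a' b c d e f g h i, diag1).
Proof. by_peq (1%:M : 'M[F]_3) (1%:M : 'M[F]_3) (1 : F) (a' - a) (0 : F) (1 : F). Qed.

(** Transformations acting only on the last two rows and columns preserve [diag1], so the lower 2x2
    block of [A] can be given its rank normal form. Its pivots clear the border entries facing them
    at the cost of the corner, which [peq_corner] resets to 0. *)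
Lemma classified_E11 A : classified (A, diag1).
Proof.
case: (m3P A) => a u1 u2 v1 p q v2 r s -> {A}.
have [p1 [p2 [p3 [p4 [q1 [q2 [q3 [q4 [k [nP nQ k2 [e1 e2 e3 e4]]]]]]]]]]] := norm2 p q r s.
suff H a' u1' u2' v1' v2' : classified
    (m3 a' u1' u2' v1' (0 < k)%N%:R 0 v2' 0 (1 < k)%N%:R, diag1).
  apply: classified_peq (H a (u1 * q1 + u2 * q3) (u1 * q2 + u2 * q4)
    (p1 * v1 + p2 * v2) (p3 * v1 + p4 * v2)).
  apply: (@peq_m3 _ (m3 1 0 0 0 p1 p2 0 p3 p4) (m3 1 0 0 0 q1 q2 0 q3 q4) 1 0 0 1);
    rewrite ?m3_det ?simp0 ?oner_eq0 // /diag1 ?m3E ?simp0 //.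
  by congr m3.
move: k2 a' u1' u2' v1' v2' {e1 e2 e3 e4 nP nQ p1 p2 p3 p4 q1 q2 q3 q4 p q r s a u1 u2 v1 v2}.
case: k => [|[|[|k]]] //= _ a u1 u2 v1 v2; apply: classified_peq (peq_corner _ _ _ _ _ _ _ _ _ 0) _.
(* Rank 0: only the two borders remain, and each is reduced separately to (1, 0) or to zero. *)
- have norm (x y : F) : exists q1 q2 q3 q4 : F,
     [/\ q1 * q4 - q2 * q3 != 0, x * q1 + y * q3 = ((x != 0) || (y != 0))%:R
       & x * q2 + y * q4 = 0].
    have [x0|nx] := eqVneq x 0; last first.
      exists x^-1, (- y), 0, x; rewrite !simp0 mulVf // mulfV // oner_eq0; split => //; ring.
    have [y0|ny] := eqVneq y 0; rewrite /= x0.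
      by exists 1, 0, 0, 1; rewrite y0 !simp0 oner_eq0.
    by exists 0, 1, y^-1, 0; rewrite !simp0 oppr_eq0 invr_eq0 mulfV.
  have [q1 [q2 [q3 [q4 [nq e1 e2]]]]] := norm u1 u2.
  have [p1 [p2 [p3 [p4 [np e3 e4]]]]] := norm v1 v2.
  apply: (@classified_peq _ (m3 0 ((u1 != 0) || (u2 != 0))%:R 0
                 ((v1 != 0) || (v2 != 0))%:R 0 0 0 0 0, diag1)).
    apply: (@peq_m3 _ (m3 1 0 0 0 p1 p3 0 p2 p4) (m3 1 0 0 0 q1 q2 0 q3 q4) 1 0 0 1);
      rewrite ?m3_det ?simp0 ?oner_eq0 // /diag1 ?m3E ?simp0 //; first by rewrite (mulrC p3).
    by rewrite e1 e2 ![p1 * _]mulrC ![_ * v1]mulrC ![_ * v2]mulrC e3 e4.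
  case: (_ || _); case: (_ || _) => /=.
  + exact: (@classified_rep 11).
  + exact: (@classified_rep 4).
  + exact: (@classified_rep 7).
  apply: classified_dependent; exists 1, 0.
  by rewrite oner_eq0 /comb /diag1 !m3E !simp0.

(* Rank 1: the pivot clears [u1] and [v1]; the vanishing or not of [u2] and [v2] selects one of four
   representatives. *)
- apply: (@classified_peq _ (m3 (- u1 * v1) 0 u2 0 1 0 v2 0 0, diag1)).
    by_peq (m3 1 (- u1) 0 0 1 0 0 0 1) (m3 1 0 0 (- v1) 1 0 0 0 1) (1 : F) (0 : F) (0 : F) (1 : F).
  apply: classified_peq (peq_corner _ _ _ _ _ _ _ _ _ 0) _.
  have [->|nu] := eqVneq u2 0; have [->|nv] := eqVneq v2 0.
  + exact: (@classified_rep 10).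
  + apply: (@classified_peq _ (m3 0 0 0 0 1 0 1 0 0, diag1)); last exact: (@classified_rep 8).
    by_peq (m3 1 0 0 0 1 0 0 0 v2^-1) (1%:M : 'M[F]_3) (1 : F) (0 : F) (0 : F) (1 : F).
  + apply: (@classified_peq _ (m3 0 0 1 0 1 0 0 0 0, diag1)); last exact: (@classified_rep 5).
    by_peq (1%:M : 'M[F]_3) (m3 1 0 0 0 1 0 0 0 u2^-1) (1 : F) (0 : F) (0 : F) (1 : F).
  apply: (@classified_peq _ (m3 0 0 1 0 1 0 1 0 0, diag1)); last exact: (@classified_rep 13).
  by_peq (m3 1 0 0 0 1 0 0 0 v2^-1) (m3 1 0 0 0 1 0 0 0 u2^-1) (1 : F) (0 : F) (0 : F) (1 : F).
- apply: (@classified_peq _ (m3 (- u1 * v1 - u2 * v2) 0 0 0 1 0 0 0 1, diag1)).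
    by_peq (m3 1 (- u1) (- u2) 0 1 0 0 0 1) (m3 1 0 0 (- v1) 1 0 (- v2) 0 1) (1 : F) (0 : F) (0 : F) (1 : F).
  apply: classified_peq (peq_corner _ _ _ _ _ _ _ _ _ 0) _.
  exact: (@classified_rep 12).
Qed.

Definition no_rank1 p := ~ dependent p /\ ~ has_rank 1 p.

Lemma no_rank1_peq p q : peq p q -> no_rank1 p -> no_rank1 q.
Proof.
by move=> /peq_sym qp [nd n1]; split=> H; [apply: nd|apply: n1];
  [apply: dependent_peq H | apply: has_rank_peq H].
Qed.

Lemma no_rank1_trp p : no_rank1 p -> no_rank1 (trp p).
Proof.
by move=> [nd n1]; split=> [/dependent_trp|/has_rank_trp]; rewrite trpK.
Qed.

Lemma no_rank1_comb p x y : no_rank1 p -> (x != 0) || (y != 0) ->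
  (1 < \rank (comb p x y))%N.
Proof.
move=> [nd n1] nxy; case E: (\rank (comb p x y)) => [|[|k]] //.
  case: nd; exists x, y; split => //; apply/eqP; by rewrite -mxrank_eq0 E.
by case: n1; exists x, y.
Qed.

(** At x = 0 the form is y^2, so a nontrivial zero has x nonzero and can be scaled to x = 1. Then
    [- t] is an eigenvalue of the block. *)
Lemma not_anisotropic2 (a b c d : F) : ~ anisotropic2 a b c d ->
  exists t, (a + t) * (d + t) = b * c.
Proof.
move=> na; apply: contrapT => H; apply: na => x y E.
have [x0|nx] := eqVneq x 0.
  by move: E; rewrite x0 !simp0 => /eqP; rewrite mulf_eq0 orbb => /eqP ->.
case: H; exists (y / x); apply/eqP; rewrite -subr_eq0; apply/eqP.
apply: (mulfI nx); apply: (mulfI nx); rewrite !mulr0 -E.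
by field.
Qed.

(** Conjugating to a basis that starts with a kernel vector (q1, q3) empties the first column, while
    [diag2] and the entry [w] stay fixed. *)
Lemma conj_singular (a b c d : F) : a * d = b * c -> exists b' d', forall w,
  peq (m3 a b 0 c d 0 0 0 w, diag2) (m3 0 b' 0 0 d' 0 0 0 w, diag2).
Proof.
move=> D0.
have [q1 [q3 [nq e1 e2]]] : exists q1 q3 : F, [/\ (q1 != 0) || (q3 != 0),
    a * q1 + b * q3 = 0 & c * q1 + d * q3 = 0].
  have [/andP[/eqP a0 /eqP b0]|] := boolP ((a == 0) && (b == 0)); last first.
    rewrite negb_and => nab; exists (- b), a; rewrite oppr_eq0 orbC nab; split => //; first by ring.
    by rewrite mulrN mulrC -D0; ring.
  have [/andP[/eqP c0 /eqP d0]|] := boolP ((c == 0) && (d == 0)); last first.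
    rewrite negb_and => nab; exists (- d), c; rewrite oppr_eq0 orbC nab; split => //; last by ring.
    by rewrite a0 b0; ring.
  by exists 1, 0; rewrite a0 b0 c0 d0 !simp0 oner_eq0.
have [q2 [q4 nD]] : exists q2 q4 : F, q1 * q4 - q2 * q3 != 0.
  have [q10|nq1] := eqVneq q1 0; last by exists 0, 1; rewrite !simp0.
  by exists 1, 0; move: nq; rewrite q10 eqxx !simp0 oppr_eq0.
(* The coordinates of the image of the second basis vector (q2, q4) in the new basis. *)
exists ((q4 * (a * q2 + b * q4) - q2 * (c * q2 + d * q4)) / (q1 * q4 - q2 * q3)).
exists ((- q3 * (a * q2 + b * q4) + q1 * (c * q2 + d * q4)) / (q1 * q4 - q2 * q3)) => w.
pose D := q1 * q4 - q2 * q3.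
by_pq (m3 (q4 / (q1 * q4 - q2 * q3)) (- q2 / (q1 * q4 - q2 * q3)) 0
          (- q3 / (q1 * q4 - q2 * q3)) (q1 / (q1 * q4 - q2 * q3)) 0 0 0 1)
      (m3 q1 q2 0 q3 q4 0 0 0 1).
- by rewrite m3_det (_ : _ + _ = D^-1) ?invr_eq0 // /D; field.
- transitivity (D^-1 * (q4 * (a * q1 + b * q3) - q2 * (c * q1 + d * q3))).
    by rewrite /D; field.
  by rewrite e1 e2; ring.
- transitivity (D^-1 * (- q3 * (a * q1 + b * q3) + q1 * (c * q1 + d * q3))).
    by rewrite /D; field.
  by rewrite e1 e2; ring.
Qed.

Lemma peq_singular a b c d w : ~ anisotropic2 a b c d -> exists b' d' : F,
  peq (m3 a b 0 c d 0 0 0 w, diag2) (m3 0 b' 0 0 d' 0 0 0 w, diag2).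
Proof.
move=> /not_anisotropic2[t /conj_singular [b' [d' H]]].
exists b', d'; apply: peq_trans (H w).
by_peq (1%:M : 'M[F]_3) (1%:M : 'M[F]_3) (1 : F) t (0 : F) (1 : F).
Qed.

(** Once the form has a zero the determinant becomes x y (d' x + y). Three distinct zeros give class
    17; for d' = 0 the block is nilpotent and gives class 14, or it is zero and a member of rank one
    appears. *)
Lemma classified_corner1 (a b c d : F) : no_rank1 (m3 a b 0 c d 0 0 0 1, diag2) ->
  classified (m3 a b 0 c d 0 0 0 1, diag2).
Proof.
move=> nr; have [an|na] := pselect (anisotropic2 a b c d).
  exists a, b, c, d, 0, 19; split; last exact: peq_refl.
  by apply: Or32; rewrite eqxx orbT.
have [b' [d' H]] := peq_singular 1 na; apply: (classified_peq H).
move/(no_rank1_peq H): nr => {H na}.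
have [->|nd] := eqVneq d' 0 => nr; last first.
  apply: (@classified_peq _ (m3 0 0 0 0 1 0 0 0 1, diag2)); last exact: (@classified_rep 17).
  by_peq (m3 1 (- b' / d') 0 0 1 0 0 0 d') (m3 1 (b' / d') 0 0 1 0 0 0 1)
    (d'^-1) (0 : F) (0 : F) (1 : F).
have [b0|nb] := eqVneq b' 0.
  have := no_rank1_comb nr (x := 1) (y := 0).
  rewrite oner_eq0 /comb /= b0 !m3E ?simp0 m3_rank !simp0 ?eqxx ?oner_eq0 /=.
  by move/(_ isT).
apply: (@classified_peq _ (m3 0 1 0 0 0 0 0 0 1, diag2)); last exact: (@classified_rep 14).
by_pq (m3 b'^-1 0 0 0 1 0 0 0 1) (m3 b' 0 0 0 1 0 0 0 1).
Qed.

(** A zero of the form yields a nontrivial member supported on a singular 2x2 block, hence of rank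
    at most one, which is excluded. *)
Lemma classified_corner0 (a b c d : F) : no_rank1 (m3 a b 0 c d 0 0 0 0, diag2) ->
  classified (m3 a b 0 c d 0 0 0 0, diag2).
Proof.
move=> nr; have [an|na] := pselect (anisotropic2 a b c d).
  exists a, b, c, d, 0, 18; split; last exact: peq_refl.
  by apply: Or32; rewrite eqxx.
have [b' [d' H]] := peq_singular 0 na.
move/(no_rank1_peq H): nr => {H na} nr.
have := no_rank1_comb nr (x := 1) (y := 0); rewrite oner_eq0 /comb /= !m3E ?simp0 m3_rank !simp0 ?eqxx /=.
by case: ifP => // _ /(_ isT).
Qed.

(** The third column of [diag2] is zero, so column operations with the pivot 1 adjust the first row
    freely; subtracting [d] times [diag2] leaves only [c], and c = 0 would give a member of rank
    one. *)
Lemma peq_row_pencil (a b c d : F) : no_rank1 (m3 a b 1 c d 0 0 0 0, diag2) ->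
  peq (m3 a b 1 c d 0 0 0 0, diag2) (m3 0 0 1 1 0 0 0 0 0, diag2).
Proof.
have H1 : peq (m3 a b 1 c d 0 0 0 0, diag2) (m3 0 0 1 c 0 0 0 0 0, diag2).
  by_peq (1%:M : 'M[F]_3) (m3 1 0 0 0 1 0 (d - a) (- b) 1) (1 : F) (- d) (0 : F) (1 : F).
move/(no_rank1_peq H1) => nr; apply: peq_trans H1 _.
have [c0|nc] := eqVneq c 0; last first.
  by_pq (m3 1 0 0 0 c^-1 0 0 0 1) (m3 1 0 0 0 c 0 0 0 1).
have := no_rank1_comb nr (x := 1) (y := 0).
rewrite oner_eq0 /comb /= c0 !m3E ?simp0 m3_rank !simp0 ?eqxx ?oner_eq0 /=.
by move/(_ isT).
Qed.

(** The determinant is x^2 ((c v2 - d v1) x - v1 y). For nonzero [v1] it has a double and a simple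
    zero, which is class 14. For v1 = 0 it is c v2 x^3, and [c] decides between 15 and the singular
    class 16. *)
Lemma classified_row_col (a b c d v1 v2 : F) : (v1 != 0) || (v2 != 0) ->
  classified (m3 a b 1 c d 0 v1 v2 0, diag2).
Proof.
have [->|nv1 _] := eqVneq v1 0 => /=.
  move=> nv2.
  apply: (@classified_peq _ (m3 0 0 1 c 0 0 0 1 0, diag2)).
    by_pq (m3 1 0 0 0 1 (- d / v2) 0 0 v2^-1) (m3 1 0 0 0 1 0 (- a) (- b) 1).
  have [->|nc] := eqVneq c 0; first exact: (@classified_rep 16).
  apply: (@classified_peq _ (m3 0 0 1 1 0 0 0 1 0, diag2)); last exact: (@classified_rep 15).
  by_pq (m3 1 0 0 0 c^-1 0 0 0 c^-1) (m3 1 0 0 0 c 0 0 0 1).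
have [a1 [b1 [c1 [d1 H]]]] : exists a1 b1 c1 d1 : F,
    peq (m3 a b 1 c d 0 v1 v2 0, diag2) (m3 a1 b1 1 c1 d1 0 1 0 0, diag2).
  exists (a + v2 / v1 * c), (- (v2 / v1) * (a + v2 / v1 * c) + (b + v2 / v1 * d)), c,
    (d - v2 / v1 * c).
  by_pq (m3 1 (v2 / v1) 0 0 1 0 0 0 v1^-1) (m3 1 (- v2 / v1) 0 0 1 0 0 0 1).
apply: (classified_peq H).
apply: (@classified_peq _ (m3 0 0 1 0 0 0 1 0 0, diag2)).
  by_peq (m3 1 0 0 0 1 (- c1) 0 0 1) (m3 1 0 0 0 1 0 (d1 - a1) (- b1) 1)
    (1 : F) (- d1) (0 : F) (1 : F).
(* The double zero is at x = 0 here but at y = 0 in the representative, so the slices are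
   exchanged. *)
apply: (@classified_peq _ (m3 0 1 0 0 0 0 0 0 1, diag2)); last exact: (@classified_rep 14).
by_peq (m3 1 0 0 0 0 1 0 1 0 : 'M[F]_3) (m3 0 1 0 0 0 1 1 0 0 : 'M[F]_3) (0 : F) (1 : F) (1 : F) (0 : F).
Qed.

(** Conjugation by a block taking (u1, u2) to (1, 0) fixes [diag2] and multiplies the row border by
    an invertible block, which preserves whether that border vanishes. *)
Lemma peq_norm_col (a b c d u1 u2 v1 v2 : F) : (u1 != 0) || (u2 != 0) ->
  exists a' b' c' d' v1' v2' : F,
    peq (m3 a b u1 c d u2 v1 v2 0, diag2) (m3 a' b' 1 c' d' 0 v1' v2' 0, diag2) /\
    ((v1' == 0) && (v2' == 0) = (v1 == 0) && (v2 == 0)).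
Proof.
have [->|nu1 _] := eqVneq u1 0 => /=.
  move=> nu2; exists d, (c / u2), (b * u2), a, (v2 * u2), v1; split.
    by_pq (m3 0 u2^-1 0 1 0 0 0 0 1) (m3 0 1 0 u2 0 0 0 0 1).
  by rewrite mulf_eq0 (negbTE nu2) orbF andbC.
exists (a + b * u2 / u1), (b / u1), ((c * u1 + d * u2) - u2 / u1 * (a * u1 + b * u2)),
   (d - u2 / u1 * b), (v1 * u1 + v2 * u2), v2; split.
  by_pq (m3 u1^-1 0 0 (- u2 / u1) 1 0 0 0 1) (m3 u1 0 0 u2 1 0 0 0 1).
have [->|_] := eqVneq v2 0; last by rewrite !andbF.
by rewrite !andbT !simp0 mulf_eq0 (negbTE nu1) orbF.
Qed.

Lemma peq_col_pencil (a b c d u1 u2 : F) : (u1 != 0) || (u2 != 0) ->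
  no_rank1 (m3 a b u1 c d u2 0 0 0, diag2) ->
  peq (m3 a b u1 c d u2 0 0 0, diag2) (m3 0 0 1 1 0 0 0 0 0, diag2).
Proof.
move=> nu nr; have [a' [b' [c' [d' [v1 [v2 [H]]]]]]] := peq_norm_col a b c d 0 0 nu.
rewrite eqxx => /andP[/eqP v10 /eqP v20]; rewrite v10 v20 in H.
by apply: (peq_trans H); apply: peq_row_pencil; apply: no_rank1_peq H nr.
Qed.

Lemma classified_I2 A : no_rank1 (A, diag2) -> classified (A, diag2).
Proof.
case: (m3P A) => a b u1 c d u2 v1 v2 w -> {A} nr.
have [w0|nw] := eqVneq w 0; last first.
  (* The pivot [w] clears both borders and leaves the Schur complement as block. *)
  have H : peq (m3 a b u1 c d u2 v1 v2 w, diag2)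
     (m3 (a - u1 * v1 / w) (b - u1 * v2 / w) 0 (c - u2 * v1 / w) (d - u2 * v2 / w) 0 0 0 1, diag2).
    by_pq (m3 1 0 (- u1 / w) 0 1 (- u2 / w) 0 0 1) (m3 1 0 0 0 1 0 (- v1 / w) (- v2 / w) w^-1).
  by apply: (classified_peq H); apply: classified_corner1; apply: no_rank1_peq H nr.
move: nr; rewrite {}w0 => nr.
have [/andP[/eqP u10 /eqP u20]|nu] := boolP ((u1 == 0) && (u2 == 0)).
  have [/andP[/eqP v10 /eqP v20]|nv] := boolP ((v1 == 0) && (v2 == 0)).
    by move: nr; rewrite u10 u20 v10 v20; apply: classified_corner0.
  (* Only the row border survives; transposition reduces this to a column border. *)
  rewrite negb_and in nv; have := peq_col_pencil (a := a) (b := c) (c := b) (d := d) nv.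
  have -> : (m3 a c v1 b d v2 0 0 0, diag2) = trp (m3 a b u1 c d u2 v1 v2 0, diag2).
    by rewrite u10 u20 /trp /diag2 /= !m3_tr.
  move=> /(_ (no_rank1_trp nr))/peq_trp; rewrite trpK => H.
  apply: (classified_peq H); rewrite /trp /diag2 /= !m3_tr; exact: (@classified_rep 9).
rewrite negb_and in nu; have [a' [b' [c' [d' [v1' [v2' [H ev]]]]]]] := peq_norm_col a b c d v1 v2 nu.
apply: (classified_peq H); have [|nv] := boolP ((v1' == 0) && (v2' == 0)); last first.
  by apply: classified_row_col; rewrite -negb_and.
case/andP => /eqP v10 /eqP v20; rewrite v10 v20 in H *.
apply: classified_peq (peq_row_pencil (no_rank1_peq H nr)) _; exact: (@classified_rep 6).
Qed.

Lemma pid1 : pid_mx 1 = diag1 :> 'M[F]_3.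
Proof. by apply/matrixP => -[[|[|[|?]]] ?] // [[|[|[|?]]] ?] //; rewrite !mxE. Qed.

Lemma pid2 : pid_mx 2 = diag2 :> 'M[F]_3.
Proof. by apply/matrixP => -[[|[|[|?]]] ?] // [[|[|[|?]]] ?] //; rewrite !mxE. Qed.

Lemma classification p : classified p.
Proof.
have [dp|nd] := pselect (dependent p); first exact: classified_dependent.
have nz x y k : \rank (comb p x y) = k.+1 -> (x != 0) || (y != 0).
  move=> rk; rewrite -negb_and; apply/negP => /andP[/eqP x0 /eqP y0].
  by move: rk; rewrite x0 y0 /comb !scale0r addr0 mxrank0.
have [[x [y r1]]|n1] := pselect (has_rank 1 p).
  have [A] := peq_pid p (nz _ _ _ r1); rewrite r1 pid1 => /classified_peq; apply.
  exact: classified_E11.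
have [[x [y r2]]|n2] := pselect (has_rank 2 p).
  have [A] := peq_pid p (nz _ _ _ r2); rewrite r2 pid2 => H.
  by apply: (classified_peq H); apply: classified_I2; apply: (no_rank1_peq H).
(* All nontrivial members are now invertible: the second slice can be made the identity, and the
   determinant has no nontrivial zero. *)
have rk3 x y : (x != 0) || (y != 0) -> \rank (comb p x y) = 3.
  move=> nxy; have := rank_leq_row (comb p x y).
  case E: (\rank (comb p x y)) => [|[|[|[|k]]]] //.
  - by case: nd; exists x, y; split => //; apply/eqP; rewrite -mxrank_eq0 E.
  - by case: n1; exists x, y.
  by case: n2; exists x, y.
have u2 : p.2 \in unitmx.
  by rewrite -comb01 -row_free_unit /row_free rk3 // oner_eq0 orbT.
have := peq_mul p (unitmx1 _ 3) (_ : invmx p.2 \in unitmx); rewrite unitmx_inv => /(_ u2).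
rewrite !mul1mx mulmxV // => H; exists 0, 0, 0, 0, (p.1 *m invmx p.2), 20.
split => //; apply: Or33; split => // x y E.
have [/andP[/eqP -> /eqP ->]//|] := boolP ((x == 0) && (y == 0)).
rewrite negb_and => /rk3/eqP; rewrite rank3P => /eqP; case.
rewrite -[comb p x y](mulmxKV u2) det_mulmx (_ : comb p x y *m _ = x *: (p.1 *m invmx p.2) + y%:M).
  by rewrite E mul0r.
by rewrite /comb mulmxDl -!scalemxAl mulmxV // scalemx1.
Qed.

End Classification.

(** * Anisotropic pencils over finite, real closed and algebraically closed fields *)

Lemma horner_mx_comp (F : fieldType) n (M : 'M[F]_n.+1) (p q : {poly F}) :
  horner_mx M (p \Po q) = horner_mx (horner_mx M q) p.
Proof.
elim/poly_ind: p => [|p c IH]; first by rewrite comp_poly0 !rmorph0.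
by rewrite comp_polyD comp_polyM comp_polyX comp_polyC !rmorphD !rmorphM /= IH
  !horner_mx_C horner_mx_X.
Qed.

(** * Similarity of matrices killed by the same irreducible polynomial of full degree *)

Section Similarity.
Variables (F : fieldType) (n : nat) (f : {poly F}).
Hypothesis irr_f : irreducible_poly f.
Hypothesis size_f : size f = n.+2.
Implicit Types M : 'M[F]_n.+1.

Let v : 'rV[F]_n.+1 := delta_mx 0 0.
(* Its rows form a basis in which M is the companion matrix of f. *)
Definition krylov M := \matrix_(i < n.+1) (v *m M ^+ i).

Lemma mul_krylov M u : u *m krylov M = v *m horner_mx M (rVpoly u).
Proof.
rewrite mulmx_sum_row /rVpoly poly_def linear_sum mulmx_sumr; apply: eq_bigr => i _.
by rewrite rowK linearZ /= rmorphXn /= horner_mx_X valK scalemxAr.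
Qed.

(** A dependency between the rows is a nonzero polynomial u of degree below that of [f] with v u(M)
    = 0. It is coprime to [f], and a Bezout identity evaluated at [M] gives v = 0. *)
Lemma krylov_unit M : horner_mx M f = 0 -> krylov M \in unitmx.
Proof.
move=> fM; rewrite -row_free_unit; apply/inj_row_free => u.
rewrite mul_krylov => vp; apply/eqP; apply: contraPT (oner_neq0 F) => nu.
have np : rVpoly u != 0 by apply: contra_neq nu => p0; rewrite -[u]rVpolyK p0 linear0.
have : coprimep f (rVpoly u).
  rewrite irreducible_poly_coprime //; apply/negP => /(dvdp_leq np).
  by rewrite size_f leqNgt ltnS size_poly.
move/Bezout_eq1_coprimepP => -[[a b]] /= /(congr1 (horner_mx M)).
rewrite rmorphD !rmorphM /= fM mulr0 add0r rmorph1 => /(congr1 (mulmx v)).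
rewrite [_ * _]comm_horner_mx2 -mulmxE mulmxA vp mul0mx mulmx1 => /matrixP/(_ 0 0).
by rewrite !mxE !eqxx => ->; rewrite eqxx.
Qed.

(** The quotient of the two Krylov matrices sends v p(M) to v p(M') for every polynomial p, since
    both sides depend only on p modulo [f]. *)
Lemma similar_of_root M M' : horner_mx M f = 0 -> horner_mx M' f = 0 ->
  exists2 K : 'M[F]_n.+1, K \in unitmx & M *m K = K *m M'.
Proof.
move=> fM fM'; have uK := krylov_unit fM; have uK' := krylov_unit fM'.
exists (invmx (krylov M) *m krylov M'); first by rewrite unitmx_mul unitmx_inv uK.
have H (p : {poly F}) : v *m horner_mx M p *m (invmx (krylov M) *m krylov M') = v *m horner_mx M' p.
  have mod (N : 'M[F]_n.+1) : horner_mx N f = 0 -> horner_mx N p = horner_mx N (p %% f).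
    by move=> fN; rewrite [in LHS](divp_eq p f) rmorphD rmorphM /= fN mulr0 add0r.
  have sz : (size (p %% f)%R <= n.+1)%N.
    by rewrite -ltnS -size_f ltn_modp irredp_neq0.
  rewrite (mod _ fM) (mod _ fM') -(poly_rV_K sz) -!mul_krylov mulmxA.
  by rewrite mulmxK.
apply: (can_inj (mulKmx uK)); rewrite !mulmxA mulmxV // mul1mx.
apply/row_matrixP => i; rewrite -!mulmxA row_mul rowK [in RHS]row_mul rowK !mulmxA.
have := H ('X^(i.+1))%R; rewrite !rmorphXn /= !horner_mx_X !exprSr -!mulmxE !mulmxA => E; exact: E.
Qed.

End Similarity.

Definition anisotropic (F : fieldType) n (M : 'M[F]_n) :=
  forall x y, \det (x *: M + y%:M) = 0 -> x = 0 /\ y = 0.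

(** In degrees 2 and 3 the absence of roots is irreducibility, and a root would be an eigenvalue of
    [M], hence a zero of the form. *)
Lemma anisotropic_irreducible (F : fieldType) n (M : 'M[F]_n.+1) :
  (0 < n < 3)%N -> anisotropic M -> irreducible_poly (char_poly M).
Proof.
move=> n3 an; apply: cubic_irreducible; first by rewrite size_char_poly; case/andP: n3.
move=> x; rewrite -eigenvalue_root_char; apply/negP => /eigenvalueP[v vM nv].
suff /an[/eqP] : \det (1 *: M + (- x)%:M) = 0 by rewrite oner_eq0.
apply/eqP/det0P; exists v => //.
by rewrite mulmxDr scale1r vM mul_mx_scalar scaleNr subrr.
Qed.

(* With N = #|F[X]/f| = #|F[X]/g|, g divides X^N - X, which splits over F[X]/f. *)
Lemma finite_root_transfer (F : finFieldType) (f g : {poly F}) :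
  f \is monic -> g \is monic -> irreducible_poly f -> irreducible_poly g ->
  size f = size g -> exists h, f %| (g \Po h).
Proof.
move=> mf mg irf irg sz.
have fI : monic_irreducible_poly f by [].
have gI : monic_irreducible_poly g by [].
have in0 (h : {poly F}) : monic_irreducible_poly h ->
    forall p, (in_qpoly h p == 0) = (h %| p).
  move=> hI p; have [_ hM] := hI; apply/eqP/idP => [/val_eqP /= | hDp].
    by rewrite -Pdiv.IdomainMonic.modpE mk_monicE.
  by apply/val_eqP; rewrite /= -Pdiv.IdomainMonic.modpE mk_monicE.
have dg : g %| 'X^(#|{poly %/ f with fI}|) - 'X.
  rewrite -(in0 g gI) rmorphB rmorphXn /= subr_eq0; apply/eqP.
  rewrite card_qfpoly sz -(card_qfpoly gI); exact: (@expf_card {poly %/ g with gI} (in_qpoly g 'X)).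
have [q Eq] := dvdpP _ _ dg; set N := #|_| in Eq.
have N1 : (1 < N)%N by apply: card_qfpoly_gt1.
have sXN : size ('X^N - 'X : {poly F}) = N.+1.
  by rewrite size_polyDl ?size_polyXn // size_polyN size_polyX ltnS.
have nq : q != 0.
  by apply: contra_eq_neq Eq => ->; rewrite mul0r -size_poly_gt0 sXN.
have ng : g != 0 by rewrite monic_neq0.
have szq : (size q <= N)%N.
  have := sXN; rewrite Eq size_mul // => E; have [sg _] := irg.
  by rewrite -ltnS -E; case: (size g) sg => [|[|s]] // _; rewrite !addnS /= ltnS leq_addr.
(* If no element of K = F[X]/f were a root of [g], all N elements would be roots of the cofactor
   [q], whose degree is below N. *)
apply: contrapT => H.
pose K := {poly %/ f with fI}.
pose p : {poly K} := map_poly (qfpoly_const fI) q.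
have np : p != 0.
  apply: contra_neq nq => p0; apply: (@map_fpoly_div_inj _ _ fI).
  by rewrite map_poly0 -p0.
have rp : all (root p) (enum K).
  apply/allP => k _; rewrite /root; apply/eqP.
  have kE : k = in_qpoly f (val k) :> {poly %/ f}.
    by apply: val_inj; symmetry; apply: in_qpoly_small; apply: size_mk_monic.
  have Ep : p.[k] = in_qpoly f (q \Po val k) by rewrite in_qpoly_comp_horner -kE.
  have Eg : in_qpoly f (g \Po val k) != 0 :> K.
    by apply/negP; rewrite (in0 f fI) => fg; apply: H; exists (val k).
  rewrite Ep; apply: (mulIf Eg); rewrite mul0r.
  have := congr1 (fun r => in_qpoly f (r \Po val k)) Eq.
  rewrite comp_polyM rmorphM /= => <-.
  rewrite comp_polyB comp_polyX comp_Xn_poly rmorphB rmorphXn /= -kE.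
  by apply/eqP; rewrite subr_eq0; apply/eqP; exact: (@expf_card {poly %/ f with fI} k).
have := max_poly_roots np rp (enum_uniq _); rewrite -cardE ltnNge.
by rewrite (leq_trans (size_poly _ _) szq).
Qed.

(** * Pencils consisting of a 2x2 block and a corner entry *)

Section Blocks.
Variable F : fieldType.

Definition m2 (a b c d : F) : 'M[F]_2 :=
  \matrix_(r, s) nth 0 (nth [::] [:: [:: a; b]; [:: c; d]] r) s.

Definition corner (M : 'M[F]_2) (w : F) : 'M[F]_3 :=
  block_mx M 0 0 (w%:M : 'M[F]_1) : 'M[F]_(2 + 1).

Lemma corner_m2 a b c d w : corner (m2 a b c d) w = m3 a b 0 c d 0 0 0 w.
Proof.
apply/matrixP => r s; rewrite !mxE.
by case: splitP => -[[|[|?]] ?] //= Er; rewrite !mxE; case: splitP => -[[|[|?]] ?] //= Es;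
  rewrite !mxE ?Er ?Es.
Qed.

Lemma corner_1 : corner 1%:M 0 = diag2.
Proof.
rewrite (_ : 1%:M = m2 1 0 0 1) ?corner_m2 //.
by apply/matrixP => -[[|[|?]] ?] // [[|[|?]] ?] //; rewrite !mxE.
Qed.

Lemma det_m2 a b c d : \det (m2 a b c d) = a * d - b * c.
Proof.
rewrite (expand_det_row _ ord0) !big_ord_recl big_ord0 !mxE /= addr0.
by rewrite /cofactor !det_mx11 !mxE /=; ring.
Qed.

Lemma anisotropic_m2 a b c d : anisotropic2 a b c d <-> anisotropic (m2 a b c d).
Proof.
have E x y : \det (x *: m2 a b c d + y%:M) = (x * a + y) * (x * d + y) - (x * b) * (x * c).
  rewrite -det_m2; congr (\det _).
  by apply/matrixP => -[[|[|?]] ?] // [[|[|?]] ?] //; rewrite !mxE /= ?mulr1n ?mulr0n ?addr0.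
by split=> H x y; [rewrite E; exact: H | rewrite -E; exact: H].
Qed.

Lemma corner_unit M w : w != 0 -> M \in unitmx -> corner M w \in unitmx.
Proof.
move=> nw uM; have := block_diag_mx_unit M (w%:M : 'M[F]_1).
by rewrite uM [w%:M \in _]unitmxE det_scalar expr1 unitfE nw => H; exact: H.
Qed.

Lemma corner_mul M N w z : corner M w *m corner N z = corner (M *m N) (w * z).
Proof.
apply: (etrans (mulmx_block M 0 0 (w%:M : 'M_1) N 0 0 (z%:M : 'M_1))).
by rewrite !(mulmx0, mul0mx, addr0, add0r) -scalar_mxM.
Qed.

Lemma corner_lin x y M N w z :
  x *: corner M w + y *: corner N z = corner (x *: M + y *: N) (x * w + y * z).
Proof.
apply: (etrans (congr2 +%R (scale_block_mx x M 0 0 (w%:M : 'M_1))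
  (scale_block_mx y N 0 0 (z%:M : 'M_1)))).
apply: (etrans (add_block_mx _ _ _ _ _ _ _ _)).
by rewrite !scaler0 !addr0 !scale_scalar_mx -raddfD.
Qed.

(** An affine change of [M] is a mixing of the slices. It also multiplies the corner by [s], which
    the entry [s^-1] of the left factor undoes. *)
Lemma peq_corner_similar (M M' K : 'M[F]_2) (s t w : F) : s != 0 -> K \in unitmx ->
  (s *: M + t%:M) *m K = K *m M' -> peq (corner M w, diag2) (corner M' w, diag2).
Proof.
move=> ns uK E.
exists s, t, 0, 1, (corner (invmx K) s^-1), (corner K 1).
split; first by rewrite mulr1 mulr0 subr0.
- by rewrite corner_unit ?invr_eq0 ?unitmx_inv.
- by rewrite corner_unit ?oner_eq0.
rewrite -corner_1 /comb /= !corner_lin !corner_mul scale0r !scale1r !add0r.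
rewrite mulmx1 mulVmx // scalemx1 -[_ *m _ *m K]mulmxA E mulKmx //.
by rewrite !simp0 mulrA mulVf // mul1r.
Qed.

End Blocks.

(** * From the classification to complete lists of classes *)

Section Completeness.
Variable F : fieldType.

Definition complete N (a b c d : F) M :=
  (forall p, (idx p < N)%N /\ peq p (rep a b c d M (idx p))) /\
  (forall i, (i < N)%N -> idx (rep a b c d M i) = i).

Lemma rep_split (a b c d a' b' c' d' : F) M M' i : (i < 18)%N ->
  rep a b c d M i = rep a' b' c' d' M' i.
Proof. by move: i => [|[|[|[|[|[|[|[|[|[|[|[|[|[|[|[|[|[|i]]]]]]]]]]]]]]]]]]. Qed.

(** The corner [w] is left free so that w = 0 and w = 1 cover the representatives 18 and 19
    together. *)
Definition unique_quadratic (a b c d : F) := forall a' b' c' d' w,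
  anisotropic2 a' b' c' d' -> peq (m3 a' b' 0 c' d' 0 0 0 w, diag2) (m3 a b 0 c d 0 0 0 w, diag2).
Definition unique_cubic (M : 'M[F]_3) := forall M',
  anisotropic3 M' -> peq (M', 1%:M) (M, 1%:M).
Definition no_quadratic := forall a b c d : F, ~ anisotropic2 a b c d.
Definition no_cubic := forall M : 'M[F]_3, ~ anisotropic3 M.

Lemma idx_valid (a b c d : F) M i : valid a b c d M i -> idx (rep a b c d M i) = i.
Proof.
case=> [i18|[/orP[]/eqP -> an]|[-> an]].
- exact: idx_rep_split.
- exact: idx_rep18.
- exact: idx_rep19.
exact: idx_rep20.
Qed.

Lemma completeI N a b c d M :
  (forall i, (i < N)%N -> valid a b c d M i) ->
  (forall p, exists i, (i < N)%N /\ peq p (rep a b c d M i)) -> complete N a b c d M.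
Proof.
move=> V H; split=> [p|i iN]; last by apply: idx_valid; apply: V.
by have [i [iN pi]] := H p; rewrite (idx_peq pi) idx_valid //; apply: V.
Qed.

Lemma complete18 : no_quadratic -> no_cubic -> complete 18 (0 : F) 0 0 0 0.
Proof.
move=> nq nc; apply: completeI => [i i18|p]; first exact: Or31.
have [a [b [c [d [M [i [[i18|[_ /nq]//|[_ /nc]//] H]]]]]]] := classification p.
by exists i; split => //; rewrite (rep_split 0 0 0 0 a b c d 0 M).
Qed.

Lemma complete20 a b c d : anisotropic2 a b c d -> unique_quadratic a b c d ->
  no_cubic -> complete 20 a b c d 0.
Proof.
move=> an uq nc; apply: completeI => [i|p].
  rewrite ltnS leq_eqVlt => /orP[/eqP ->|]; first by apply: Or32; rewrite eqxx orbT.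
  by rewrite ltnS leq_eqVlt => /orP[/eqP ->|i18]; [apply: Or32 | apply: Or31].
have [a' [b' [c' [d' [M [i [[i18|[i2 an']|[_ /nc]//] H]]]]]]] := classification p.
  exists i; split; first by rewrite (ltn_trans i18).
  by rewrite (rep_split a b c d a' b' c' d' 0 M).
exists i; split; first by case/orP: i2 => /eqP ->.
apply: (peq_trans H); case/orP: i2 => /eqP ->; exact: uq.
Qed.

Lemma complete21 a b c d M : anisotropic2 a b c d -> unique_quadratic a b c d ->
  anisotropic3 M -> unique_cubic M -> complete 21 a b c d M.
Proof.
move=> an uq an3 uc; apply: completeI => [i|p].
  rewrite ltnS leq_eqVlt => /orP[/eqP ->|]; first exact: Or33.
  rewrite ltnS leq_eqVlt => /orP[/eqP ->|]; first by apply: Or32; rewrite eqxx orbT.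
  by rewrite ltnS leq_eqVlt => /orP[/eqP ->|i18]; [apply: Or32 | apply: Or31].
have [a' [b' [c' [d' [M' [i [[i18|[i2 an']|[i20 an']] H]]]]]]] := classification p.
- exists i; split; first by rewrite (ltn_trans i18).
  by rewrite (rep_split a b c d a' b' c' d' M M').
- exists i; split; first by case/orP: i2 => /eqP ->.
  apply: (peq_trans H); case/orP: i2 => /eqP ->; exact: uq.
by exists 20; split => //; apply: (peq_trans H); rewrite i20; apply: uc.
Qed.

Lemma root_isotropic n (M : 'M[F]_n) x : root (char_poly M) x -> ~ anisotropic M.
Proof.
rewrite -eigenvalue_root_char => /eigenvalueP[v vM nv] an.
suff /an[/eqP] : \det (1 *: M + (- x)%:M) = 0 by rewrite oner_eq0.
apply/eqP/det0P; exists v => //.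
by rewrite mulmxDr scale1r vM mul_mx_scalar scaleNr subrr.
Qed.

End Completeness.

Lemma closed_complete (F : closedFieldType) : complete 18 (0 : F) 0 0 0 0.
Proof.
have nan n (M : 'M[F]_n.+1) : ~ anisotropic M.
  have [x] : exists x, root (char_poly M) x by apply/closed_rootP; rewrite size_char_poly.
  exact: root_isotropic.
apply: complete18 => [a b c d|M]; last exact: nan.
by move/anisotropic_m2; apply: nan.
Qed.

(** * Real closed fields *)

Section Reals.
Variable R : rcfType.

Lemma real_no_cubic : no_cubic R.
Proof.
move=> M; set p := char_poly M.
have szp : size p = 4 by apply: size_char_poly.
have lp : p`_3 = 1 by have /monicP := char_poly_monic M; rewrite lead_coefE szp.
(* A Cauchy bound: where the argument has absolute value [B], the cubic term dominates the others,
   so the intermediate value theorem applies between [- B] and [B]. *)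
pose B := 1 + `|p`_0| + `|p`_1| + `|p`_2|.
have E x : p.[x] = p`_0 + p`_1 * x + p`_2 * x ^+ 2 + x ^+ 3.
  rewrite (@horner_coef_wide _ 4) ?szp // !big_ord_recr big_ord0 /= lp.
  by rewrite add0r mulr1 expr1 mul1r.
have n0 := normr_ge0 p`_0; have n1 := normr_ge0 p`_1; have n2 := normr_ge0 p`_2.
have B1 : 1 <= B by rewrite /B; lra.
have key x : `|x| = B -> `|p`_0 + p`_1 * x + p`_2 * x ^+ 2| <= B ^+ 3.
  move=> xB; rewrite (le_trans (ler_normD _ _)) // normrM normrX xB.
  rewrite (le_trans (lerD (ler_normD _ _) (lexx _))) // normrM xB.
  have BB : B <= B ^+ 2 by rewrite expr2 ler_peMl //; lra.
  have h0 : `|p`_0| <= `|p`_0| * B ^+ 2 by rewrite ler_peMr //; lra.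
  have h1 : `|p`_1| * B <= `|p`_1| * B ^+ 2 by rewrite ler_wpM2l.
  have -> : B ^+ 3 = (1 + `|p`_0| + `|p`_1| + `|p`_2|) * B ^+ 2 by rewrite exprS.
  rewrite !mulrDl; lra.
have [||x _] := @poly_ivt _ p (- B) B; last exact: root_isotropic.
  lra.
apply/andP; split; rewrite E.
  have := key (- B); rewrite normrN ger0_norm; last by lra.
  move=> /(_ erefl); rewrite ler_norml => /andP[_]; rewrite !exprS expr0; lra.
have := key B; rewrite ger0_norm; last by lra.
by move=> /(_ erefl); rewrite ler_norml => /andP[]; rewrite !exprS expr0; lra.
Qed.

(** The form is x^2 + y^2. *)
Lemma real_anisotropic2 : anisotropic2 (0 : R) 1 (- 1) 0.
Proof.
move=> x y; rewrite !mulr0 !add0r mulr1 mulrN1 mulrN opprK => /eqP.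
by rewrite paddr_eq0 ?sqr_ge0 -?expr2 ?sqr_ge0 // !sqrf_eq0 => /andP[/eqP -> /eqP ->].
Qed.

Lemma real_unique_quadratic : unique_quadratic (0 : R) 1 (- 1) 0.
Proof.
move=> a b c d w an.
(* Minus the discriminant of (a + t)(d + t) - b c as a polynomial in t; anisotropy makes it
   positive. *)
pose D := - ((a - d) ^+ 2 + 4 * (b * c)).
have D0 : 0 < D.
  rewrite ltNge; apply/negP => nD.
  have [] := an 2 (- (a + d) + Num.sqrt (- D)); last by move/eqP; rewrite pnatr_eq0.
  have := sqr_sqrtr (_ : 0 <= - D); rewrite oppr_ge0 => /(_ nD).
  set r := Num.sqrt _ => r2.
  transitivity (r ^+ 2 + D); last by rewrite r2; ring.
  by rewrite /D; ring.
pose r := Num.sqrt D.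
have r2 : r ^+ 2 = D by rewrite sqr_sqrtr // ltW.
have nr : r != 0 by rewrite sqrtr_eq0 -ltNge.
have nc : c != 0.
  apply/eqP => c0; have [] := an 1 (- d); last by move/eqP; rewrite oner_eq0.
  by rewrite c0; ring.
have bE : b = - (r ^+ 2 + (a - d) ^+ 2) / (4 * c) by rewrite r2 /D; field.
rewrite bE.
have n2 : (2 : R) != 0 by rewrite pnatr_eq0.
have n4 : (4 : R) != 0 by rewrite pnatr_eq0.
(* Removing the trace and scaling by 2 / r turns the block into some J with J^2 = -1. The columns of
   the right factor are J e1 and e1, a basis in which J has rows (0, 1) and (-1, 0); the entry
   [r / 2] restores [w]. *)
apply: (@peq_m3 _ (m3 0 (r / (2 * c)) 0 1 (- (a - d) / (2 * c)) 0 0 0 (r / 2))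
  (m3 ((a - d) / r) 1 0 (2 * c / r) 0 0 0 0 1) (2 / r) (- (a + d) / r) 0 1).
- by rewrite m3_det !simp0 oppr_eq0 !mulf_neq0 // ?invr_eq0 ?mulf_neq0.
- rewrite m3_det !simp0 oppr_eq0 !mulf_neq0 ?invr_eq0 //.
- by rewrite !simp0 mulf_neq0 ?invr_eq0.
- by rewrite /diag2 !m3E; congr m3; field; rewrite ?nr ?nc ?n2 ?n4.
by rewrite /diag2 !m3E; congr m3; field; rewrite ?nr ?nc ?n2 ?n4.
Qed.

Lemma real_complete : complete 20 (0 : R) 1 (- 1) 0 0.
Proof.
apply: complete20; [exact: real_anisotropic2 | exact: real_unique_quadratic
  | exact: real_no_cubic].
Qed.

End Reals.

(** * Finite fields *)

Lemma poly_size2 (R : nzRingType) (p : {poly R}) : (size p <= 2)%N ->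
  p = p`_1 *: 'X + (p`_0)%:P.
Proof.
move=> sp; apply/polyP => -[|[|i]]; rewrite coefD coefZ coefX coefC /= ?mulr0 ?mulr1 ?add0r ?addr0 //.
by rewrite nth_default // (leq_trans sp).
Qed.

Lemma horner_mx_size2 (F : fieldType) n (M : 'M[F]_n.+1) (p : {poly F}) :
  (size p <= 2)%N -> horner_mx M p = p`_1 *: M + (p`_0)%:M.
Proof. by move/poly_size2 => {1}->; rewrite rmorphD /= linearZ /= horner_mx_C horner_mx_X. Qed.

Section RootTransfer.
Variables (F : finFieldType) (n : nat) (M C : 'M[F]_n.+1).
Hypotheses (n12 : (0 < n < 3)%N) (anM : anisotropic M) (anC : anisotropic C).

(** F[M] is a field containing a root of the characteristic polynomial of [C]; written as a reduced
    polynomial in [M], this root is a matrix similar to [C]. *)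
Lemma conjugate_polynomial : exists h : {poly F}, (size h <= n.+1)%N /\
  horner_mx (horner_mx M h) (char_poly C) = 0.
Proof.
have irf := anisotropic_irreducible n12 anM.
have [h fgh] : exists h, char_poly M %| (char_poly C \Po h).
  apply: (finite_root_transfer (char_poly_monic M) (char_poly_monic C) irf).
    exact: anisotropic_irreducible.
  by rewrite !size_char_poly.
have MM := Cayley_Hamilton M.
have mod : horner_mx M h = horner_mx M (h %% char_poly M).
  by rewrite [in LHS](divp_eq h (char_poly M)) rmorphD rmorphM /= MM mulr0 add0r.
exists (h %% char_poly M); split.
  by rewrite -ltnS -(size_char_poly M) ltn_modp irredp_neq0.
rewrite -mod -horner_mx_comp.
have [q ->] := dvdpP _ _ fgh.
by rewrite rmorphM /= MM mulr0.
Qed.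

(** Excludes degenerate transformations of [M]: these would produce a scalar matrix, but [C] has no
    eigenvalue in [F]. *)
Lemma horner_scalar_neq0 x : horner_mx (x%:M : 'M[F]_n.+1) (char_poly C) != 0.
Proof.
have -> : x%:M = horner_mx C x%:P :> 'M_n.+1 by rewrite horner_mx_C.
rewrite -horner_mx_comp comp_polyCr horner_mx_C.
apply/eqP => /matrixP/(_ 0 0); rewrite !mxE eqxx mulr1n => /eqP rx.
exact: (root_isotropic rx).
Qed.

End RootTransfer.

Section Finite.
Variable F : finFieldType.

(** A surjective self-map of a finite set is injective. Applied to x^2 - x and x^3 - x, which agree
    at 0 and 1, this gives constants c for which X^2 - X - c and X^3 - X - c have no root. *)
Lemma not_inj_not_surj (f : F -> F) : f 0 = f 1 -> exists c, forall x, f x != c.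
Proof.
move=> f01; apply: contrapT => H.
have inj : injective f.
  have sur y : exists x, f x == y.
    apply: contrapT => Hy; apply: H; exists y => x; apply/negP => E; apply: Hy; by exists x.
  pose g y := xchoose (sur y).
  have gK : cancel g f by move=> y; apply/eqP; exact: (xchooseP (sur y)).
  have gb := injF_bij (can_inj gK).
  exact: (bij_inj (bij_can_bij gb gK)).
by move/eqP: (inj _ _ f01); rewrite eq_sym oner_eq0.
Qed.

Lemma finite_anisotropic2 : exists c : F, anisotropic2 0 1 c 1.
Proof.
have [|c Hc] := @not_inj_not_surj (fun x => x ^+ 2 - x); first by ring.
exists c => x y E.
have [x0|nx] := eqVneq x 0.
  by move: E; rewrite x0 !simp0 => /eqP; rewrite mulf_eq0 orbb => /eqP ->.
case/eqP: (Hc (- y / x)); apply: (mulfI nx); apply: (mulfI nx).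
apply/eqP; rewrite -subr_eq0 -E; apply/eqP; by field.
Qed.

Lemma finite_anisotropic3 : exists M : 'M[F]_3, anisotropic3 M.
Proof.
have [|c Hc] := @not_inj_not_surj (fun x => x ^+ 3 - x); first by ring.
(* The companion matrix of X^3 - X - c. *)
exists (m3 0 1 0 0 0 1 c 1 0) => x y; rewrite -scalemx1 !m3E m3_det !simp0 => E.
have [x0|nx] := eqVneq x 0.
  by move: E; rewrite x0 !simp0 => /eqP; rewrite !mulf_eq0 !orbb => /eqP ->.
case/eqP: (Hc (- y / x)); apply: (mulfI nx); apply: (mulfI nx); apply: (mulfI nx).
apply/eqP; rewrite -subr_eq0 -oppr_eq0 -E; apply/eqP; by field.
Qed.

(** A reduced polynomial in a 2x2 matrix is already affine, so the matrix similar to [C] comes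
    directly from mixing slices. Its slope is nonzero because a scalar matrix is no root. *)
Lemma finite_unique_quadratic (a b c d : F) :
  anisotropic2 a b c d -> unique_quadratic a b c d.
Proof.
move=> /anisotropic_m2 an a' b' c' d' w /anisotropic_m2 an'; rewrite -!corner_m2.
move: (m2 a b c d) (m2 a' b' c' d') an an' => C M an an' {a b c d a' b' c' d'}.
have [h [sh gh]] := conjugate_polynomial (isT : (0 < 1 < 3)%N) an' an.
have [K uK E] := similar_of_root (anisotropic_irreducible (isT : (0 < 1 < 3)%N) an)
  (size_char_poly C) gh (Cayley_Hamilton C).
rewrite horner_mx_size2 // in E gh.
apply: peq_corner_similar uK E; apply: contraPneq gh => ->.
by rewrite scale0r add0r; apply/eqP; apply: horner_scalar_neq0.
Qed.

Lemma finite_unique_cubic (C : 'M[F]_3) : anisotropic C -> unique_cubic C.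
Proof.
move=> an M an'.
have [h [sh gh]] := conjugate_polynomial (isT : (0 < 2 < 3)%N) an' an.
set N := horner_mx M h in gh; set f := char_poly M.
(* c and d cancel the coefficient of X^2 in h (c X + d) modulo f, so that N is a
   Moebius transform of M. *)
have [c [d [ncd rcd]]] : exists c d : F, (c != 0) || (d != 0) /\
    (size ((h * (c *: 'X + d%:P)) %% f)%R <= 2)%N.
  have sz (p : {poly F}) : (p %% f)`_2 = 0 -> (size (p %% f)%R <= 2)%N.
    move=> p2; apply/leq_sizeP => j; rewrite leq_eqVlt => /orP[/eqP <- //|j3].
    apply: nth_default; rewrite (leq_trans _ j3) // -ltnS -(size_char_poly M).
    by rewrite ltn_modp monic_neq0 // char_poly_monic.
  have E c d : (h * (c *: 'X + d%:P)) %% f = c *: ((h * 'X) %% f) + d *: (h %% f).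
    by rewrite mulrDr -scalerAr [h * _%:P]mulrC mul_polyC modpD !modpZl.
  have [h20|nh2] := eqVneq ((h %% f)`_2) 0.
    by exists 0, 1; rewrite oner_eq0 orbT; split => //; apply: sz; rewrite E scale0r add0r scale1r.
  exists ((h %% f)`_2), (- ((h * 'X) %% f)`_2); rewrite nh2; split => //.
  by apply: sz; rewrite E coefD !coefZ; ring.
set r := _ %% f in rcd; pose U := c *: M + d%:M.
have NU : N *m U = r`_1 *: M + (r`_0)%:M.
  rewrite -horner_mx_size2 //.
  have -> : horner_mx M r = horner_mx M (h * (c *: 'X + d%:P)).
    rewrite [in RHS](divp_eq (h * _) f) rmorphD rmorphM /= Cayley_Hamilton mulr0 add0r //.
  by rewrite rmorphM rmorphD /= linearZ /= horner_mx_C horner_mx_X.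
have uU : U \in unitmx.
  rewrite unitmxE unitfE; apply: contraTneq ncd => /an' [-> ->].
  by rewrite eqxx.
(* Proportional coefficients would make [N] scalar. *)
have nD : r`_1 * d - r`_0 * c != 0.
  apply/negP => /eqP D0.
  have [l [l1 l0]] : exists l, r`_1 = l * c /\ r`_0 = l * d.
    have [c0|nc] := eqVneq c 0.
      move: ncd D0; rewrite c0 eqxx mulr0 subr0 /= => nd /eqP.
      by rewrite mulf_eq0 (negbTE nd) orbF => /eqP ->; exists (r`_0 / d); rewrite mulr0 mulfVK.
    exists (r`_1 / c); rewrite mulfVK //; split => //.
    by apply: (mulfI nc); rewrite mulrC -(subr0_eq D0); field.
  move: NU; rewrite l1 l0 (_ : _ + _ = l%:M *m U); last first.
    by rewrite mul_scalar_mx scalerDr scalerA scale_scalar_mx.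
  move/(can_inj (mulmxK uU)) => NE; move: gh; rewrite NE => /eqP; apply/negP.
  exact: horner_scalar_neq0.
have [K uK E] := similar_of_root (anisotropic_irreducible (isT : (0 < 2 < 3)%N) an)
  (size_char_poly C) gh (Cayley_Hamilton C).
(* Mixing the slices gives (N U, U); the right factor cancels [U], and [K] conjugates [N] to [C]. *)
exists (r`_1), (r`_0), c, d, (invmx K), (invmx U *m K).
rewrite unitmx_mul !unitmx_inv uU uK; split => //; congr pair.
  by rewrite /comb /= scalemx1 -NU !mulmxA mulmxK // -mulmxA E mulKmx.
by rewrite /comb /= scalemx1 -/U mulmxA mulmxK // mulVmx.
Qed.

Lemma finite_complete : exists (a b c d : F) M, complete 21 a b c d M.
Proof.
have [c an2] := finite_anisotropic2; have [M an3] := finite_anisotropic3.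
exists 0, 1, c, 1, M; apply: complete21 => //; first exact: finite_unique_quadratic.
exact: finite_unique_cubic.
Qed.

End Finite.

(** * The stabiliser of the fundamental tensors *)

Section Parallel.
Variable F : fieldType.

(** The zero vector is parallel to everything, so transitivity requires a nonzero middle vector. *)
Definition par n (u v : 'rV[F]_n) := forall i j, u 0 i * v 0 j = u 0 j * v 0 i.

Lemma row_neq0 n (u : 'rV[F]_n) : u != 0 -> exists i, u 0 i != 0.
Proof.
move=> nu; apply: contrapT => H; case/eqP: nu; apply/rowP => i; rewrite mxE.
by apply: contrapT => /eqP ui; apply: H; exists i.
Qed.

Lemma par_sym n (u v : 'rV[F]_n) : par u v -> par v u.
Proof. by move=> H i j; rewrite mulrC -H mulrC. Qed.

Lemma par_scale n (u v : 'rV[F]_n) : u != 0 -> par u v -> exists l, v = l *: u.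
Proof.
move=> /row_neq0[i ui] uv; exists (v 0 i / u 0 i); apply/rowP => j; rewrite mxE.
by apply: (mulfI ui); rewrite uv; field.
Qed.

Lemma scale_par n (u : 'rV[F]_n) l : par u (l *: u).
Proof. by move=> i j; rewrite !mxE; ring. Qed.

Lemma par_trans n (u v w : 'rV[F]_n) : v != 0 -> par u v -> par v w -> par u w.
Proof.
move=> nv /par_sym/(par_scale nv)[l ->] /(par_scale nv)[m ->] i j.
by rewrite !mxE; ring.
Qed.

Lemma not_par_neq0 n (u v : 'rV[F]_n) : ~ par u v -> u != 0 /\ v != 0.
Proof.
by move=> H; split; apply/eqP => E; apply: H => i j; rewrite E !mxE; ring.
Qed.

Lemma not_par_indep n (u v : 'rV[F]_n) x y : ~ par u v -> x *: u + y *: v = 0 -> x = 0 /\ y = 0.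
Proof.
move=> uv E; have [nu nv] := not_par_neq0 uv.
have [x0|nx] := eqVneq x 0.
  by move/eqP: E; rewrite x0 scale0r add0r scaler_eq0 (negbTE nv) orbF => /eqP.
case: uv; rewrite (_ : u = (- y / x) *: v); first by apply/par_sym; apply: scale_par.
apply: (scalerI nx); rewrite scalerA (_ : x * (- y / x) = - y); last by field.
by apply/eqP; rewrite scaleNr -addr_eq0 E.
Qed.

Lemma not_par_add n (u v : 'rV[F]_n) : ~ par u v -> ~ par u (u + v).
Proof. by move=> H E; apply: H => i j; have := E i j; rewrite !mxE !mulrDr [u 0 j * u 0 i]mulrC => /addrI. Qed.

Lemma not_par_mul n (u v : 'rV[F]_n) (M : 'M_n) : M \in unitmx -> ~ par u v -> ~ par (u *m M) (v *m M).
Proof.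
move=> uM uv uvM; have [nu nv] := not_par_neq0 uv; apply: uv.
have [|l E] := par_scale _ uvM.
  by apply: contra_neq nu => E; rewrite -[u](mulmxK uM) E mul0mx.
rewrite -[v](mulmxK uM) E -scalemxAl mulmxK //; exact: scale_par.
Qed.

End Parallel.

Section Fundamental.
Variables (F : fieldType) (a b c : nat).
Implicit Types (u : 'rV[F]_a) (v : 'rV[F]_b) (w : 'rV[F]_c) (t : tensor F a b c).

Lemma scale_tensorE x t p : (x *: t) p = x * t p.
Proof. by rewrite ffunE. Qed.

Lemma tens_linear1 x u u' v w : tens (x *: u + u') v w = x *: tens u v w + tens u' v w.
Proof. by apply/ffunP => p; rewrite !ffunE !mxE /GRing.scale /=; ring. Qed.

Lemma tens_linear2 x u v v' w : tens u (x *: v + v') w = x *: tens u v w + tens u v' w.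
Proof. by apply/ffunP => p; rewrite !ffunE !mxE /GRing.scale /=; ring. Qed.

Lemma tens_linear3 x u v w w' : tens u v (x *: w + w') = x *: tens u v w + tens u v w'.
Proof. by apply/ffunP => p; rewrite !ffunE !mxE /GRing.scale /=; ring. Qed.

Lemma tens_scale1 x u v w : tens (x *: u) v w = x *: tens u v w.
Proof. by apply/ffunP => p; rewrite !ffunE !mxE /GRing.scale /=; ring. Qed.

Lemma tens_scale2 x u v w : tens u (x *: v) w = x *: tens u v w.
Proof. by apply/ffunP => p; rewrite !ffunE !mxE /GRing.scale /=; ring. Qed.

Lemma tens_scale3 x u v w : tens u v (x *: w) = x *: tens u v w.
Proof. by apply/ffunP => p; rewrite !ffunE !mxE /GRing.scale /=; ring. Qed.

Lemma tens_eq0 u v w : (tens u v w == 0) = [|| u == 0, v == 0 | w == 0].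
Proof.
apply/idP/idP => [/eqP E|].
  apply: contraT; rewrite !negb_or => /and3P[/row_neq0[i ui] /row_neq0[j vj] /row_neq0[k wk]].
  move/ffunP/(_ (i, j, k)): E; rewrite !ffunE /= => /eqP.
  by rewrite !mulf_eq0 (negbTE ui) (negbTE vj) (negbTE wk).
by case/or3P => /eqP ->; apply/eqP/ffunP => p; rewrite !ffunE !mxE ?mul0r ?mulr0 ?mul0r.
Qed.

Lemma fundamental_tens u v w : fundamental (tens u v w) <-> [/\ u != 0, v != 0 & w != 0].
Proof.
split=> [[u' [v' [w' [nu nv nw E]]]]|[nu nv nw]]; last by exists u, v, w.
have : tens u v w != 0 by rewrite E tens_eq0 !negb_or nu nv nw.
by rewrite tens_eq0 !negb_or => /and3P.
Qed.

Definition share u v w u' v' w' :=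
  [\/ par v v' /\ par w w', par u u' /\ par w w' | par u u' /\ par v v'].

Lemma fundamental_minors t : fundamental t ->
  [/\ forall i j k i' j' k', t (i, j, k) * t (i', j', k') = t (i', j, k) * t (i, j', k'),
      forall i j k i' j' k', t (i, j, k) * t (i', j', k') = t (i, j', k) * t (i', j, k')
    & forall i j k i' j' k', t (i, j, k) * t (i', j', k') = t (i, j, k') * t (i', j', k)].
Proof.
by move=> [u [v [w [_ _ _ ->]]]]; split => *; rewrite !ffunE /=; ring.
Qed.

(** The hypothesis says that v ⊗ w and v' ⊗ w' are proportional; fixing one nonzero coordinate of
    each vector exhibits the factor. *)
Lemma par_tens n m (v v' : 'rV[F]_n) (w w' : 'rV[F]_m) :
  v != 0 -> v' != 0 -> w != 0 -> w' != 0 ->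
  (forall j k j' k', v 0 j * w 0 k * (v' 0 j' * w' 0 k') = v 0 j' * w 0 k' * (v' 0 j * w' 0 k)) ->
  par v v' /\ par w w'.
Proof.
move=> /row_neq0[j vj] /row_neq0[j' vj'] /row_neq0[k wk] /row_neq0[k' wk'] H.
have E j1 k1 : v' 0 j1 * w' 0 k1 = (v' 0 j * w' 0 k) / (v 0 j * w 0 k) * (v 0 j1 * w 0 k1).
  have nz : v 0 j * w 0 k != 0 by rewrite mulf_neq0.
  apply: (mulfI nz); rewrite H; field; by rewrite vj wk.
set m0 := _ / _ in E.
split=> i1 i2.
  apply: (mulIf wk'); rewrite -!mulrA !E; ring.
apply: (mulfI vj'); rewrite !(mulrCA (v' 0 j')) !E; ring.
Qed.

(** In the relation exchanging first indices, the sum contributes a minor of (u, u') times a minor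
    of (v ⊗ w, v' ⊗ w'). So either u and u' are parallel or both other pairs are; the same holds in
    each position, and together these leave two parallel pairs. *)
Lemma fundamental_share u v w u' v' w' : u != 0 -> v != 0 -> w != 0 ->
  u' != 0 -> v' != 0 -> w' != 0 ->
  fundamental (tens u v w + tens u' v' w') -> share u v w u' v' w'.
Proof.
move=> nu nv nw nu' nv' nw' /fundamental_minors[m1 m2 m3].
have S1 : par u u' \/ par v v' /\ par w w'.
  have [p1|np] := pselect (par u u'); [by left | right].
  apply: par_tens => // j k j' k'.
  have [i [i' nii]] : exists i i', u 0 i * u' 0 i' - u 0 i' * u' 0 i != 0.
    apply: contrapT => H; apply: np => i i'; apply/eqP; rewrite -subr_eq0.
    by apply/negPn/negP => K; apply: H; exists i, i'.
  apply: (mulfI nii); apply/eqP; rewrite -subr_eq0; apply/eqP.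
  have := m1 i j k i' j' k'; rewrite !ffunE /= => /eqP; rewrite -subr_eq0 => /eqP <-; ring.
have S2 : par v v' \/ par u u' /\ par w w'.
  have [p1|np] := pselect (par v v'); [by left | right].
  apply: par_tens => // i k i' k'.
  have [j [j' nii]] : exists i i', v 0 i * v' 0 i' - v 0 i' * v' 0 i != 0.
    apply: contrapT => H; apply: np => j j'; apply/eqP; rewrite -subr_eq0.
    by apply/negPn/negP => K; apply: H; exists j, j'.
  apply: (mulfI nii); apply/eqP; rewrite -subr_eq0; apply/eqP.
  have := m2 i j k i' j' k'; rewrite !ffunE /= => /eqP; rewrite -subr_eq0 => /eqP <-; ring.
have S3 : par w w' \/ par u u' /\ par v v'.
  have [p1|np] := pselect (par w w'); [by left | right].
  apply: par_tens => // i j i' j'.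
  have [k [k' nii]] : exists i i', w 0 i * w' 0 i' - w 0 i' * w' 0 i != 0.
    apply: contrapT => H; apply: np => k k'; apply/eqP; rewrite -subr_eq0.
    by apply/negPn/negP => K; apply: H; exists k, k'.
  apply: (mulfI nii); apply/eqP; rewrite -subr_eq0; apply/eqP.
  have := m3 i j k i' j' k'; rewrite !ffunE /= => /eqP; rewrite -subr_eq0 => /eqP <-; ring.
have SS : (par v v' /\ par w w') \/ (par u u' /\ par w w') \/ (par u u' /\ par v v') by tauto.
by case: SS => [|[|]] ?; [apply: Or31 | apply: Or32 | apply: Or33].
Qed.

Lemma fundamental_neighbour u v w t' : u != 0 -> v != 0 -> w != 0 ->
  fundamental t' -> fundamental (tens u v w + t') ->
  [\/ exists u', t' = tens u' v w, exists v', t' = tens u v' w | exists w', t' = tens u v w'].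
Proof.
move=> nu nv nw [u' [v' [w' [nu' nv' nw' ->]]]] /fundamental_share[] // -[p1 p2].
- have [l ->] := par_scale nv p1; have [m ->] := par_scale nw p2; apply: Or31.
  by exists (l *: (m *: u')); rewrite !(tens_scale1, tens_scale2, tens_scale3).
- have [l ->] := par_scale nu p1; have [m ->] := par_scale nw p2; apply: Or32.
  exists (l *: (m *: v')); rewrite !(tens_scale1, tens_scale2, tens_scale3) //.
have [l ->] := par_scale nu p1; have [m ->] := par_scale nv p2; apply: Or33.
by exists (l *: (m *: w')); rewrite !(tens_scale1, tens_scale2, tens_scale3).
Qed.

End Fundamental.

(** * Linear spaces of fundamental tensors *)

Section Families.
Variables (F : fieldType) (a b c : nat).
Local Notation V := (tensor F a b c).

Lemma tens_row1 n (x : 'rV[F]_n) (U : 'M_(n, a)) (v : 'rV_b) (w : 'rV_c) :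
  tens (x *m U) v w = \sum_j x 0 j *: tens (row j U) v w.
Proof.
apply/ffunP => p; rewrite sum_ffunE !ffunE mxE !mulr_suml.
by apply: eq_bigr => j _; rewrite scale_tensorE !ffunE !mxE !mulrA.
Qed.

Lemma tens_row2 n (x : 'rV[F]_n) (u : 'rV_a) (U : 'M_(n, b)) (w : 'rV_c) :
  tens u (x *m U) w = \sum_j x 0 j *: tens u (row j U) w.
Proof.
apply/ffunP => p; rewrite sum_ffunE !ffunE mxE mulr_sumr !mulr_suml.
by apply: eq_bigr => j _; rewrite scale_tensorE !ffunE !mxE; ring.
Qed.

Lemma tens_row3 n (x : 'rV[F]_n) (u : 'rV_a) (v : 'rV_b) (U : 'M_(n, c)) :
  tens u v (x *m U) = \sum_j x 0 j *: tens u v (row j U).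
Proof.
apply/ffunP => p; rewrite sum_ffunE !ffunE mxE mulr_sumr.
by apply: eq_bigr => j _; rewrite scale_tensorE !ffunE !mxE; ring.
Qed.

Lemma tens_inj_par (u u' : 'rV_a) (v v' : 'rV_b) (w w' : 'rV_c) :
  u != 0 -> v != 0 -> w != 0 -> tens u v w = tens u' v' w' :> V ->
  [/\ par u u', par v v' & par w w'].
Proof.
move=> /row_neq0[i ui] /row_neq0[j vj] /row_neq0[k wk] /ffunP E.
have E' i' j' k' : u 0 i' * v 0 j' * w 0 k' = u' 0 i' * v' 0 j' * w' 0 k'.
  by have := E (i', j', k'); rewrite !ffunE.
split; apply: par_sym.
- rewrite (_ : u = (v' 0 j * w' 0 k / (v 0 j * w 0 k)) *: u'); first exact: scale_par.
  apply/rowP => i'; rewrite mxE; apply: (mulIf vj); apply: (mulIf wk); rewrite E'.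
  by field; rewrite vj wk.
- rewrite (_ : v = (u' 0 i * w' 0 k / (u 0 i * w 0 k)) *: v'); first exact: scale_par.
  apply/rowP => i'; rewrite mxE; apply: (mulfI ui); apply: (mulIf wk); rewrite E'.
  by field; rewrite ui wk.
rewrite (_ : w = (u' 0 i * v' 0 j / (u 0 i * v 0 j)) *: w'); first exact: scale_par.
apply/rowP => i'; rewrite mxE; apply: (mulfI vj); apply: (mulfI ui); rewrite mulrA E'.
by field; rewrite ui vj.
Qed.

(** Each basis image differs from the image of the basis vector 0 in a single slot, since their sum
    is fundamental. Images varying in two different slots would have a sum that is not fundamental,
    so one slot serves for all. *)
Lemma linear_family n (phi : {linear 'rV[F]_n.+1 -> V}) :
  (forall x, x != 0 -> fundamental (phi x)) ->
  [\/ exists v w (U : 'M_(n.+1, a)), forall x, phi x = tens (x *m U) v w,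
      exists u w (U : 'M_(n.+1, b)), forall x, phi x = tens u (x *m U) w
    | exists u v (U : 'M_(n.+1, c)), forall x, phi x = tens u v (x *m U)].
Proof.
move=> Hphi; pose e j : 'rV[F]_n.+1 := delta_mx 0 j.
have ne j : e j != 0.
  by apply/eqP => /rowP/(_ j); rewrite !mxE !eqxx => /eqP; rewrite oner_eq0.
have phiE x : phi x = \sum_j x 0 j *: phi (e j).
  by rewrite [in LHS](row_sum_delta x) linear_sum; apply: eq_bigr => j _; rewrite linearZ.
have indep j k : j != k -> forall l, phi (e j) != l *: phi (e k).
  move=> jk l; rewrite -subr_eq0 -linearZ -linearB.
  have : e j - l *: e k != 0.
    apply/eqP => /rowP/(_ j); rewrite !mxE !eqxx (negbTE jk) /= mulr0 subr0.
    by move/eqP; rewrite oner_eq0.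
  move/Hphi => [u [v [w [nu nv nw ->]]]].
  by rewrite tens_eq0 !negb_or nu nv nw.
have [u [v [w [nu nv nw E0]]]] := Hphi _ (ne 0).
pose K1 j := exists u', phi (e j) = tens u' v w.
pose K2 j := exists v', phi (e j) = tens u v' w.
pose K3 j := exists w', phi (e j) = tens u v w'.
have neigh j : [\/ K1 j, K2 j | K3 j].
  have [->|nj] := eqVneq j 0; first by apply: Or31; exists u.
  apply: fundamental_neighbour => //; first exact: Hphi.
  rewrite -E0 -linearD; apply: Hphi; apply/eqP => /rowP/(_ j).
  by rewrite !mxE !eqxx (negbTE nj) /= add0r => /eqP; rewrite oner_eq0.
have sum_neq0 j k : j != k -> fundamental (phi (e j) + phi (e k)).
  move=> jk; rewrite -linearD; apply: Hphi; apply/eqP => /rowP/(_ j).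
  by rewrite !mxE !eqxx (negbTE jk) /= addr0 => /eqP; rewrite oner_eq0.
have nzero j u' v' w' : phi (e j) = tens u' v' w' -> [/\ u' != 0, v' != 0 & w' != 0].
  by move=> E; apply/fundamental_tens; rewrite -E; apply: Hphi.
have p1 j u' : j != 0 -> phi (e j) = tens u' v w -> ~ par u u'.
  move=> j0 E /(par_scale nu)[l El]; move: (indep _ _ j0 l); rewrite E E0 El tens_scale1.
  by rewrite eqxx.
have p2 j v' : j != 0 -> phi (e j) = tens u v' w -> ~ par v v'.
  move=> j0 E /(par_scale nv)[l El]; move: (indep _ _ j0 l); rewrite E E0 El tens_scale2.
  by rewrite eqxx.
have p3 j w' : j != 0 -> phi (e j) = tens u v w' -> ~ par w w'.
  move=> j0 E /(par_scale nw)[l El]; move: (indep _ _ j0 l); rewrite E E0 El tens_scale3.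
  by rewrite eqxx.
have K12 j k : j != 0 -> k != 0 -> K1 j -> K2 k -> False.
  move=> j0 k0 [u' Ej] [v' Ek].
  have [nu' _ _] := nzero _ _ _ _ Ej; have [_ nv' _] := nzero _ _ _ _ Ek.
  have P1 := p1 _ _ j0 Ej; have P2 := p2 _ _ k0 Ek; have [jk|jk] := eqVneq j k.
    move: Ek; rewrite -jk Ej => /(tens_inj_par nu' nv nw)[/par_sym] //.
  have := sum_neq0 _ _ jk; rewrite Ej Ek => /fundamental_share.
  by move=> /(_ nu' nv nw nu nv' nw) [[]|[/par_sym]|[/par_sym]].
have K13 j k : j != 0 -> k != 0 -> K1 j -> K3 k -> False.
  move=> j0 k0 [u' Ej] [w' Ek].
  have [nu' _ _] := nzero _ _ _ _ Ej; have [_ _ nw'] := nzero _ _ _ _ Ek.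
  have P1 := p1 _ _ j0 Ej; have P3 := p3 _ _ k0 Ek; have [jk|jk] := eqVneq j k.
    move: Ek; rewrite -jk Ej => /(tens_inj_par nu' nv nw)[/par_sym] //.
  have := sum_neq0 _ _ jk; rewrite Ej Ek => /fundamental_share.
  by move=> /(_ nu' nv nw nu nv nw') [[]|[/par_sym]|[/par_sym]].
have K23 j k : j != 0 -> k != 0 -> K2 j -> K3 k -> False.
  move=> j0 k0 [v' Ej] [w' Ek].
  have [_ nv' _] := nzero _ _ _ _ Ej; have [_ _ nw'] := nzero _ _ _ _ Ek.
  have P2 := p2 _ _ j0 Ej; have P3 := p3 _ _ k0 Ek; have [jk|jk] := eqVneq j k.
    move: Ek; rewrite -jk Ej => /(tens_inj_par nu nv' nw)[_ /par_sym] //.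
  have := sum_neq0 _ _ jk; rewrite Ej Ek => /fundamental_share.
  by move=> /(_ nu nv' nw nu nv nw') [[/par_sym]|[]|[_ /par_sym]].
have K0 : [/\ K1 0, K2 0 & K3 0] by split; [exists u | exists v | exists w].
have [all1|/existsNP] := pselect (forall j, K1 j).
  have [f Hf] := choice all1; apply: Or31; exists v, w, (\matrix_j f j) => x.
  by rewrite phiE tens_row1; apply: eq_bigr => j _; rewrite rowK Hf.
move=> [j1 n1].
have [all2|/existsNP] := pselect (forall j, K2 j).
  have [f Hf] := choice all2; apply: Or32; exists u, w, (\matrix_j f j) => x.
  by rewrite phiE tens_row2; apply: eq_bigr => j _; rewrite rowK Hf.
move=> [j2 n2].
have [all3|/existsNP] := pselect (forall j, K3 j).
  have [f Hf] := choice all3; apply: Or33; exists u, v, (\matrix_j f j) => x.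
  by rewrite phiE tens_row3; apply: eq_bigr => j _; rewrite rowK Hf.
move=> [j3 n3].
have j10 : j1 != 0 by apply/eqP => E; case: K0; rewrite -E.
have j20 : j2 != 0 by apply/eqP => E; case: K0; rewrite -E.
have j30 : j3 != 0 by apply/eqP => E; case: K0; rewrite -E.
have := K12 j2 j1; have := K13 j2 j1; have := K23 j1 j2; have := K23 j3 j1; have := K12 j3 j1.
have := K12 j3 j2; have := K13 j3 j1; have := K13 j3 j2; have := K23 j3 j2.
by move: (neigh j1) (neigh j2) (neigh j3) => [] // ? [] // ? [] // ?; tauto.
Qed.

End Families.

(** * The action of triples of matrices and the exchange of equal factors *)

Section Action.
Variables (F : fieldType) (a b c : nat).
Local Notation V := (tensor F a b c).

Definition act (U : 'M[F]_a) (V' : 'M[F]_b) (W : 'M[F]_c) (t : V) : V :=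
  [ffun p => \sum_q t q * (U q.1.1 p.1.1 * V' q.1.2 p.1.2 * W q.2 p.2)].

Lemma act_is_linear U V' W : linear (act U V' W).
Proof.
move=> x t s; apply/ffunP => p; rewrite !ffunE /GRing.scale /= mulr_sumr -big_split /=.
by apply: eq_bigr => q _; rewrite !ffunE /GRing.scale /=; ring.
Qed.

HB.instance Definition _ U V' W :=
  GRing.isLinear.Build F V V _ (act U V' W) (act_is_linear U V' W).

Lemma act_tens U V' W u v w : act U V' W (tens u v w) = tens (u *m U) (v *m V') (w *m W).
Proof.
apply/ffunP => -[[i j] k]; rewrite !ffunE /= !mxE.
rewrite big_distrlr /= pair_bigA /= mulr_suml.
under [RHS]eq_bigr do rewrite mulr_sumr.
rewrite pair_bigA /=; apply: eq_bigr => -[[i' j'] k'] _; rewrite !ffunE /=; ring.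
Qed.

Definition e_ {n} (i : 'I_n) : 'rV[F]_n := delta_mx 0 i.

Lemma tens_decomposition (t : V) : t = \sum_q t q *: tens (e_ q.1.1) (e_ q.1.2) (e_ q.2).
Proof.
apply/ffunP => p; rewrite sum_ffunE (bigD1 p) //= big1 ?addr0 => [|q nq].
  by rewrite scale_tensorE !ffunE !mxE !eqxx !mulr1.
rewrite scale_tensorE !ffunE !mxE !eqxx /=.
case: p q nq => [[i j] k] [[i' j'] k'] /= nq.
rewrite (eq_sym i) (eq_sym j) (eq_sym k); move: nq; rewrite !xpair_eqE.
by case: (_ == i) => //; case: (_ == j) => //; case: (_ == k) => //= _; rewrite ?(mul0r, mulr0).
Qed.

Lemma linear_tens_ext (V2 : lmodType F) (f g : {linear V -> V2}) :
  (forall u v w, u != 0 -> v != 0 -> w != 0 -> f (tens u v w) = g (tens u v w)) -> f =1 g.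
Proof.
move=> fg t; rewrite (tens_decomposition t) !linear_sum; apply: eq_bigr => q _.
rewrite !linearZ fg // /e_; apply/eqP => /rowP; [move/(_ q.1.1) | move/(_ q.1.2)| move/(_ q.2)];
  by rewrite !mxE !eqxx => /eqP; rewrite oner_eq0.
Qed.

Lemma act_mul U V' W U' V'' W' t :
  act U' V'' W' (act U V' W t) = act (U *m U') (V' *m V'') (W *m W') t.
Proof.
apply: (@linear_tens_ext _ (act U' V'' W' \o act U V' W) (act (U *m U') (V' *m V'') (W *m W'))).
by move=> u v w _ _ _; rewrite /= !act_tens !mulmxA.
Qed.

Lemma act1 t : act 1%:M 1%:M 1%:M t = t.
Proof.
apply: (@linear_tens_ext _ (act 1%:M 1%:M 1%:M) idfun).
by move=> u v w _ _ _; rewrite /= !act_tens !mulmx1.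
Qed.

Lemma act_inducedH U V' W : U \in unitmx -> V' \in unitmx -> W \in unitmx ->
  inducedH (linfun (act U V' W)).
Proof.
move=> uU uV uW; split; last first.
  by exists U, V', W; split => // u v w; rewrite lfunE /= act_tens.
rewrite /GLV /=; apply/lker0P => s t; rewrite !lfunE /= => E.
rewrite -[s]act1 -[t]act1 -(mulmxV uU) -(mulmxV uV) -(mulmxV uW) -!act_mul E //.
Qed.

Lemma inducedHP (h : 'End(V)) : inducedH h -> exists U V' W,
  [/\ U \in unitmx, V' \in unitmx, W \in unitmx & forall t, h t = act U V' W t].
Proof.
move=> [_ [U [V' [W [uU uV uW H]]]]]; exists U, V', W; split => //.
by apply: (@linear_tens_ext _ h (act U V' W)) => u v w _ _ _; rewrite /= H act_tens.
Qed.

End Action.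

Section Swap.
Variables (F : fieldType) (a b : nat).
Local Notation V := (tensor F a b b).

Definition swap (t : V) : V := [ffun p => t (p.1.1, p.2, p.1.2)].

Lemma swap_is_linear : linear swap.
Proof. by move=> x t s; apply/ffunP => p; rewrite !ffunE. Qed.

HB.instance Definition _ := GRing.isLinear.Build F V V _ swap swap_is_linear.

Lemma swapK : involutive swap.
Proof. by move=> t; apply/ffunP => -[[i j] k]; rewrite !ffunE. Qed.

Lemma swap_tens u v w : swap (tens u v w) = tens u w v.
Proof. by apply/ffunP => p; rewrite !ffunE /= mulrAC. Qed.

Lemma swap_act U V' W t : swap (act U V' W t) = act U W V' (swap t).
Proof.
apply: (@linear_tens_ext _ _ _ _ _ (swap \o act U V' W) (act U W V' \o swap)).
by move=> u v w _ _ _; rewrite /= !act_tens !swap_tens act_tens.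
Qed.

Lemma swap_fundamental t : fundamental t -> fundamental (swap t).
Proof.
by move=> [u [v [w [nu nv nw ->]]]]; rewrite swap_tens; exists u, w, v.
Qed.

Lemma swap_stabG : stabG (linfun swap).
Proof.
split; first by rewrite /GLV /=; apply/lker0P => s t; rewrite !lfunE; apply: (can_inj swapK).
apply/seteqP; split=> [_ [t ft <-]|t ft].
  by rewrite lfunE; apply: swap_fundamental.
by exists (swap t); [apply: swap_fundamental | rewrite lfunE /= swapK].
Qed.

End Swap.

Section Slots.
Variables (F : fieldType) (a b c : nat).
Local Notation V := (tensor F a b c).

Definition slot1 (v : 'rV[F]_b) (w : 'rV[F]_c) (u : 'rV[F]_a) : V := tens u v w.
Definition slot2 (u : 'rV[F]_a) (w : 'rV[F]_c) (v : 'rV[F]_b) : V := tens u v w.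
Definition slot3 (u : 'rV[F]_a) (v : 'rV[F]_b) (w : 'rV[F]_c) : V := tens u v w.

Lemma slot1_is_linear v w : linear (slot1 v w).
Proof. by move=> x u u'; apply: tens_linear1. Qed.
Lemma slot2_is_linear u w : linear (slot2 u w).
Proof. by move=> x v v'; apply: tens_linear2. Qed.
Lemma slot3_is_linear u v : linear (slot3 u v).
Proof. by move=> x w w'; apply: tens_linear3. Qed.

HB.instance Definition _ v w :=
  GRing.isLinear.Build F 'rV[F]_a V _ (slot1 v w) (slot1_is_linear v w).
HB.instance Definition _ u w :=
  GRing.isLinear.Build F 'rV[F]_b V _ (slot2 u w) (slot2_is_linear u w).
HB.instance Definition _ u v :=
  GRing.isLinear.Build F 'rV[F]_c V _ (slot3 u v) (slot3_is_linear u v).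

Lemma tens_add1 u u' v w : tens (u + u') v w = tens u v w + tens u' v w :> V.
Proof. exact: (linearD (slot1 v w)). Qed.
Lemma tens_add2 u v v' w : tens u (v + v') w = tens u v w + tens u v' w :> V.
Proof. exact: (linearD (slot2 u w)). Qed.
Lemma tens_add3 u v w w' : tens u v (w + w') = tens u v w + tens u v w' :> V.
Proof. exact: (linearD (slot3 u v)). Qed.

(** Proportionality at both [x] and e + x, with equality at [e], forces both factors to be 1 by
    independence of [e] and [x]. *)
Lemma linear_scalar_eq n (G H : {linear 'rV[F]_n -> V}) (e : 'rV[F]_n) :
  injective H -> G e = H e -> (forall x, ~ par e x -> exists l, G x = l *: H x) ->
  forall x, ~ par e x -> G x = H x.
Proof.
move=> injH Ge Gx x ex; have [l El] := Gx _ ex.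
have [m Em] := Gx _ (not_par_add ex).
have /(not_par_indep ex)[/eqP m1 /eqP] : (1 - m) *: e + (l - m) *: x = 0.
  apply: injH; rewrite linear0 linearD !linearZ /= !scalerBl scale1r addrACA -opprD -scalerDr.
  by rewrite -(linearD H) -Em linearD El Ge subrr.
by rewrite El; move: m1; rewrite !subr_eq0 => /eqP <- /eqP ->; rewrite scale1r.
Qed.

End Slots.

Lemma unitmx_of_inj (F : fieldType) n (M : 'M[F]_n) :
  (forall x : 'rV_n, x != 0 -> x *m M != 0) -> M \in unitmx.
Proof.
move=> H; rewrite -row_free_unit; apply/inj_row_free => x xM.
by apply/eqP; apply: contraT => /H; rewrite xM eqxx.
Qed.

(** This is what prevents a factor of dimension 3 from being sent into the factor of dimension 2. *)
Lemma wide_kernel (F : fieldType) (M : 'M[F]_(3, 2)) : exists x : 'rV_3, x != 0 /\ x *m M = 0.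
Proof.
have : kermx M != 0.
  by rewrite -mxrank_eq0 mxrank_ker subn_eq0 -ltnNge ltnS rank_leq_col.
by case/rowV0Pn => x /sub_kermxP xM nx; exists x.
Qed.

(** * Rigidity: agreement with a triple on the three slots through a base tensor *)

Section Structure.
Variable F : fieldType.
Local Notation V := (tensor F 2 3 3).
Variable f : {linear V -> V}.
Hypothesis f_inj : injective f.
Hypothesis f_fund : forall t, fundamental t -> fundamental (f t).

Local Notation e0 := (e_ F ord0).

Lemma e0_neq0 n : (e_ F ord0 : 'rV_n.+1) != 0.
Proof. by apply/eqP => /rowP/(_ 0); rewrite !mxE !eqxx => /eqP; rewrite oner_eq0. Qed.

Lemma e0_npar n : ~ par (e_ F ord0 : 'rV_n.+2) (e_ F 1).
Proof. by move=> /(_ 0 1); rewrite !mxE !eqxx /= mul1r mul0r => /eqP; rewrite oner_eq0. Qed.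

Variables (U : 'M[F]_2) (V' W : 'M[F]_3).
Hypotheses (uU : U \in unitmx) (uV : V' \in unitmx) (uW : W \in unitmx).
Local Notation h := (act U V' W).
Hypothesis f1 : forall x, f (tens x e0 e0) = h (tens x e0 e0).
Hypothesis f2 : forall x, f (tens e0 x e0) = h (tens e0 x e0).
Hypothesis f3 : forall x, f (tens e0 e0 x) = h (tens e0 e0 x).

Lemma h_inj : injective h.
Proof.
apply: (can_inj (g := act (invmx U) (invmx V') (invmx W))) => t.
by rewrite act_mul !mulmxV // act1.
Qed.

Lemma f_share u v w u' v' w' a b c : f (tens u v w) = tens a b c ->
  f (tens u' v' w') = h (tens u' v' w') -> fundamental (tens u v w) ->
  fundamental (tens u' v' w') -> fundamental (tens u v w + tens u' v' w') ->
  share a b c (u' *m U) (v' *m V') (w' *m W).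
Proof.
move=> E E' /f_fund; rewrite E => /fundamental_tens[na nb nc].
move=> /f_fund; rewrite E' act_tens => /fundamental_tens[nu nv nw].
move=> /f_fund; rewrite linearD E E' act_tens; exact: fundamental_share.
Qed.

Lemma par_scale3 a b c u v w : u != 0 -> v != 0 -> w != 0 ->
  par a (u *m U) -> par b (v *m V') -> par c (w *m W) ->
  exists l, tens a b c = l *: h (tens u v w).
Proof.
move=> nu nv nw pa pb pc; rewrite act_tens.
have nz n (x : 'rV[F]_n) M : M \in unitmx -> x != 0 -> x *m M != 0.
  by move=> uM; apply: contra_neq => xM; rewrite -[x](mulmxK uM) xM mul0mx.
have [l1 ->] := par_scale (nz _ _ _ uU nu) (par_sym pa).
have [l2 ->] := par_scale (nz _ _ _ uV nv) (par_sym pb).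
have [l3 ->] := par_scale (nz _ _ _ uW nw) (par_sym pc).
by exists (l1 * (l2 * l3)); rewrite tens_scale1 tens_scale2 tens_scale3 !scalerA mulrA.
Qed.

Lemma npar_split n (x y z : 'rV[F]_n) : z != 0 -> ~ par x y -> ~ (par z x /\ par z y).
Proof. by move=> nz H [zx zy]; apply: H; apply: par_trans nz (par_sym zx) zy. Qed.

(** The image of e0 ⊗ v ⊗ w shares two factors with each of the known images of e0 ⊗ e0 ⊗ w and e0 ⊗
    v ⊗ e0. It is thus proportional to the expected tensor or to the image of the base tensor, and
    injectivity excludes the latter. *)
Lemma agree_slice1 v w : f (tens e0 v w) = h (tens e0 v w).
Proof.
have [pv|npv] := pselect (par e0 v).
  by have [l ->] := par_scale (e0_neq0 _) pv; rewrite tens_scale2 !linearZ f3.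
have [pw|npw] := pselect (par e0 w).
  by have [l ->] := par_scale (e0_neq0 _) pw; rewrite tens_scale3 !linearZ f2.
apply: (@linear_scalar_eq _ _ _ _ _ (f \o slot2 e0 w) (h \o slot2 e0 w) e0) npv => //.
- move=> x y /h_inj /eqP; rewrite -subr_eq0 -linearB /slot2 /= tens_eq0.
  by have [_ /negbTE ->] := not_par_neq0 npw; rewrite (negbTE (e0_neq0 _)) orbF subr_eq0 => /eqP.
- exact: f3.
move=> {}v npv /=; rewrite /slot2.
have [_ nv] := not_par_neq0 npv; have [_ nw] := not_par_neq0 npw.
have n0 n := @e0_neq0 n.
have fX : fundamental (tens e0 v w : V) by apply/fundamental_tens.
have [a [b [c [na nb nc E]]]] := f_fund fX.
have S2 : share a b c (e0 *m U) (e0 *m V') (w *m W).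
  apply: (f_share E (f3 w)) => //; first exact/fundamental_tens.
  rewrite -tens_add2; apply/fundamental_tens; split => //.
  by have [] := not_par_neq0 (not_par_add npv); rewrite addrC.
have S3 : share a b c (e0 *m U) (v *m V') (e0 *m W).
  apply: (f_share E (f2 v)) => //; first exact/fundamental_tens.
  rewrite -tens_add3; apply/fundamental_tens; split => //.
  by have [] := not_par_neq0 (not_par_add npw); rewrite addrC.
have Nb := npar_split nb (not_par_mul uV npv).
have Nc := npar_split nc (not_par_mul uW npw).
have [pa [[pb pc]|[pb pc]]] : par a (e0 *m U) /\ ((par b (v *m V') /\ par c (w *m W)) \/
    (par b (e0 *m V') /\ par c (e0 *m W))).
  by case: S2 => ?; case: S3 => ?; tauto.
  by rewrite E; exact: (par_scale3 (n0 _) nv nw pa pb pc).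
have [l] := par_scale3 (n0 _) (n0 _) (n0 _) pa pb pc.
rewrite -E -f1 -linearZ -tens_scale1 => /f_inj/(tens_inj_par (n0 _) nv nw)[_ /par_sym].
by [].
Qed.

Lemma agree_slice2 u w : f (tens u e0 w) = h (tens u e0 w).
Proof.
have [pu|npu] := pselect (par e0 u).
  by have [l ->] := par_scale (e0_neq0 _) pu; rewrite tens_scale1 !linearZ f3.
have [pw|npw] := pselect (par e0 w).
  by have [l ->] := par_scale (e0_neq0 _) pw; rewrite tens_scale3 !linearZ f1.
apply: (@linear_scalar_eq _ _ _ _ _ (f \o slot1 e0 w) (h \o slot1 e0 w) e0) npu => //.
- move=> x y /h_inj /eqP; rewrite -subr_eq0 -linearB /slot1 /= tens_eq0.
  by have [_ /negbTE ->] := not_par_neq0 npw; rewrite (negbTE (e0_neq0 _)) !orbF subr_eq0 => /eqP.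
- exact: f3.
move=> {}u npu /=; rewrite /slot1.
have [_ nu] := not_par_neq0 npu; have [_ nw] := not_par_neq0 npw.
have n0 n := @e0_neq0 n.
have fX : fundamental (tens u e0 w : V) by apply/fundamental_tens.
have [a [b [c [na nb nc E]]]] := f_fund fX.
have S2 : share a b c (e0 *m U) (e0 *m V') (w *m W).
  apply: (f_share E (f3 w)) => //; first exact/fundamental_tens.
  rewrite -tens_add1; apply/fundamental_tens; split => //.
  by have [] := not_par_neq0 (not_par_add npu); rewrite addrC.
have S3 : share a b c (u *m U) (e0 *m V') (e0 *m W).
  apply: (f_share E (f1 u)) => //; first exact/fundamental_tens.
  rewrite -tens_add3; apply/fundamental_tens; split => //.
  by have [] := not_par_neq0 (not_par_add npw); rewrite addrC.
have Na := npar_split na (not_par_mul uU npu).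
have Nc := npar_split nc (not_par_mul uW npw).
have [pb [[pa pc]|[pa pc]]] : par b (e0 *m V') /\ ((par a (u *m U) /\ par c (w *m W)) \/
    (par a (e0 *m U) /\ par c (e0 *m W))).
  by case: S2 => ?; case: S3 => ?; tauto.
  by rewrite E; exact: (par_scale3 nu (n0 _) nw pa pb pc).
have [l] := par_scale3 (n0 _) (n0 _) (n0 _) pa pb pc.
rewrite -E -f1 -linearZ -tens_scale1 => /f_inj/(tens_inj_par nu (n0 _) nw)[_ _ /par_sym].
by [].
Qed.

Lemma agree_slice3 u v : f (tens u v e0) = h (tens u v e0).
Proof.
have [pu|npu] := pselect (par e0 u).
  by have [l ->] := par_scale (e0_neq0 _) pu; rewrite tens_scale1 !linearZ f2.
have [pv|npv] := pselect (par e0 v).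
  by have [l ->] := par_scale (e0_neq0 _) pv; rewrite tens_scale2 !linearZ f1.
apply: (@linear_scalar_eq _ _ _ _ _ (f \o slot1 v e0) (h \o slot1 v e0) e0) npu => //.
- move=> x y /h_inj /eqP; rewrite -subr_eq0 -linearB /slot1 /= tens_eq0.
  by have [_ /negbTE ->] := not_par_neq0 npv; rewrite (negbTE (e0_neq0 _)) !orbF subr_eq0 => /eqP.
- exact: f2.
move=> {}u npu /=; rewrite /slot1.
have [_ nu] := not_par_neq0 npu; have [_ nv] := not_par_neq0 npv.
have n0 n := @e0_neq0 n.
have fX : fundamental (tens u v e0 : V) by apply/fundamental_tens.
have [a [b [c [na nb nc E]]]] := f_fund fX.
have S2 : share a b c (e0 *m U) (v *m V') (e0 *m W).
  apply: (f_share E (f2 v)) => //; first exact/fundamental_tens.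
  rewrite -tens_add1; apply/fundamental_tens; split => //.
  by have [] := not_par_neq0 (not_par_add npu); rewrite addrC.
have S3 : share a b c (u *m U) (e0 *m V') (e0 *m W).
  apply: (f_share E (f1 u)) => //; first exact/fundamental_tens.
  rewrite -tens_add2; apply/fundamental_tens; split => //.
  by have [] := not_par_neq0 (not_par_add npv); rewrite addrC.
have Na := npar_split na (not_par_mul uU npu).
have Nb := npar_split nb (not_par_mul uV npv).
have [pc [[pa pb]|[pa pb]]] : par c (e0 *m W) /\ ((par a (u *m U) /\ par b (v *m V')) \/
    (par a (e0 *m U) /\ par b (e0 *m V'))).
  by case: S2 => ?; case: S3 => ?; tauto.
  by rewrite E; exact: (par_scale3 nu nv (n0 _) pa pb pc).
have [l] := par_scale3 (n0 _) (n0 _) (n0 _) pa pb pc.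
rewrite -E -f1 -linearZ -tens_scale1 => /f_inj/(tens_inj_par nu nv (n0 _))[_ /par_sym].
by [].
Qed.

(** Off the three slices there are three neighbours with known images, and sharing two factors with
    each already forces the expected factors up to scalars. *)
Lemma agree_act : f =1 h.
Proof.
apply: linear_tens_ext => u v w nu nv nw /=.
have [pu|npu] := pselect (par e0 u).
  by have [l ->] := par_scale (e0_neq0 _) pu; rewrite tens_scale1 !linearZ agree_slice1.
have [pv|npv] := pselect (par e0 v).
  by have [l ->] := par_scale (e0_neq0 _) pv; rewrite tens_scale2 !linearZ agree_slice2.
have [pw|npw] := pselect (par e0 w).
  by have [l ->] := par_scale (e0_neq0 _) pw; rewrite tens_scale3 !linearZ agree_slice3.
apply: (@linear_scalar_eq _ _ _ _ _ (f \o slot1 v w) (h \o slot1 v w) e0) npu => //.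
- move=> x y /h_inj /eqP; rewrite -subr_eq0 -linearB /slot1 /= tens_eq0.
  by rewrite (negbTE nv) (negbTE nw) !orbF subr_eq0 => /eqP.
- exact: agree_slice1.
move=> {nu}u npu /=; rewrite /slot1.
have [_ nu] := not_par_neq0 npu; have n0 n := @e0_neq0 n.
have fX : fundamental (tens u v w : V) by apply/fundamental_tens.
have [a [b [c [na nb nc E]]]] := f_fund fX.
have S1 : share a b c (e0 *m U) (v *m V') (w *m W).
  apply: (f_share E (agree_slice1 v w)) => //; first exact/fundamental_tens.
  rewrite -tens_add1; apply/fundamental_tens; split => //.
  by have [] := not_par_neq0 (not_par_add npu); rewrite addrC.
have S2 : share a b c (u *m U) (e0 *m V') (w *m W).
  apply: (f_share E (agree_slice2 u w)) => //; first exact/fundamental_tens.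
  rewrite -tens_add2; apply/fundamental_tens; split => //.
  by have [] := not_par_neq0 (not_par_add npv); rewrite addrC.
have S3 : share a b c (u *m U) (v *m V') (e0 *m W).
  apply: (f_share E (agree_slice3 u v)) => //; first exact/fundamental_tens.
  rewrite -tens_add3; apply/fundamental_tens; split => //.
  by have [] := not_par_neq0 (not_par_add npw); rewrite addrC.
have Na := npar_split na (not_par_mul uU npu).
have Nb := npar_split nb (not_par_mul uV npv).
have Nc := npar_split nc (not_par_mul uW npw).
have [pa [pb pc]] : par a (u *m U) /\ par b (v *m V') /\ par c (w *m W).
  by case: S1 => ?; case: S2 => ?; case: S3 => ?; tauto.
rewrite E; exact: (par_scale3 nu nv nw pa pb pc).
Qed.

End Structure.

(** * Linear preservers of fundamental tensors *)

Section Normalisation.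
Variable F : fieldType.
Local Notation V := (tensor F 2 3 3).
Local Notation e0 := (e_ F ord0).

Lemma tens_injl a b c (u u' : 'rV[F]_a) (v : 'rV_b) (w : 'rV_c) :
  v != 0 -> w != 0 -> tens u v w = tens u' v w -> u = u'.
Proof.
move=> nv nw /eqP; rewrite -subr_eq0 -(linearB (slot1 v w)) tens_eq0 (negbTE nv) (negbTE nw).
by rewrite !orbF subr_eq0 => /eqP.
Qed.

Lemma tens_injr a b c (u : 'rV[F]_a) (v : 'rV_b) (w w' : 'rV_c) :
  u != 0 -> v != 0 -> tens u v w = tens u v w' -> w = w'.
Proof.
move=> nu nv /eqP; rewrite -subr_eq0 -(linearB (slot3 u v)) tens_eq0 (negbTE nu) (negbTE nv).
by rewrite subr_eq0 => /eqP.
Qed.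

(** Once slot 2 goes to slot 2, slot 3 cannot go to slot 1 for reasons of dimension, nor to slot 2,
    whose tensors through the base image are already attained; hence it goes to slot 3, and then
    slot 1 to slot 1. *)
Lemma preserver_act (f : {linear V -> V}) (u : 'rV_2) (w : 'rV_3) (V' : 'M_3) :
  injective f -> (forall t, fundamental t -> fundamental (f t)) ->
  (forall x, f (tens e0 x e0) = tens u (x *m V') w) ->
  exists U V' W, [/\ U \in unitmx, V' \in unitmx, W \in unitmx & f =1 act U V' W].
Proof.
move=> f_inj f_fund f2; have n0 n := @e0_neq0 F n.
have f2n (x : 'rV[F]_3) : x != 0 -> [/\ u != 0, x *m V' != 0 & w != 0].
  by move=> nx; apply: (iffLR (fundamental_tens u (x *m V') w)); rewrite -f2; apply: f_fund; apply/fundamental_tens.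
have [nu nv nw] := f2n _ (n0 _).
have uV : V' \in unitmx by apply: unitmx_of_inj => x /f2n[].
(* All tensors u ⊗ v ⊗ w with these [u] and [w] are images from slot 2, so by injectivity nothing
   else is sent there. *)
have H2 (x : 'rV[F]_2) (y z v : 'rV[F]_3) : x != 0 -> y != 0 -> z != 0 -> f (tens x y z) = tens u v w -> par x e0 /\ par z e0.
  move=> nx ny nz; rewrite -[v](mulmxKV uV) -f2 => /f_inj/(tens_inj_par nx ny nz)[px _ pz].
  by split.
have fam3 : exists W, forall x, f (tens e0 e0 x) = tens u (e0 *m V') (x *m W).
  have [|[u1 [v1 [W E]]]|[u1 [w1 [M E]]]|[u1 [v1 [W E]]]] := @linear_family _ _ _ _ _ (f \o slot3 e0 e0).
  - by move=> x nx; apply: f_fund; apply: (iffRL (fundamental_tens e0 e0 x)).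
  - have [x [nx xW]] := wide_kernel W.
    have /fundamental_tens[] : fundamental (tens (x *m W) u1 v1).
      by rewrite -E; apply: f_fund; apply/fundamental_tens.
    by rewrite xW eqxx.
  - have : tens u (e0 *m V') w = tens u1 (e0 *m M) w1 by rewrite -f2 -E.
    move/(tens_inj_par nu nv nw) => [/(par_scale nu)[l1 E1] _ /(par_scale nw)[l2 E2]].
    have e1n : (e_ F 1 : 'rV_3) != 0 by have [] := not_par_neq0 (@e0_npar F 1).
    have [] := H2 e0 e0 (e_ F 1) (l1 *: (l2 *: (e_ F 1 *m M))) (n0 _) (n0 _) e1n.
      by rewrite !tens_scale2 -tens_scale3 -E2 -tens_scale1 -E1 -E.
    by move=> _ /par_sym /e0_npar.
  have : tens u (e0 *m V') w = tens u1 v1 (e0 *m W) by rewrite -f2 -E.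
  move/(tens_inj_par nu nv nw) => [/(par_scale nu)[l1 E1] /(par_scale nv)[l2 E2] _].
  exists (l1 *: (l2 *: W)) => x.
  by rewrite -!scalemxAr !tens_scale3 -tens_scale2 -E2 -tens_scale1 -E1 -E.
have [W f3] := fam3.
have uW : W \in unitmx.
  apply: unitmx_of_inj => x nx.
  have /fundamental_tens[] : fundamental (tens u (e0 *m V') (x *m W)) => //.
  by rewrite -f3; apply/f_fund/fundamental_tens.
have eW : e0 *m W = w by apply: (tens_injr nu nv); rewrite -f3 f2.
have H3 (x : 'rV[F]_2) (y z v : 'rV[F]_3) : x != 0 -> y != 0 -> z != 0 -> f (tens x y z) = tens u (e0 *m V') v -> par x e0.
  by move=> nx ny nz; rewrite -[v](mulmxKV uW) -f3 => /f_inj/(tens_inj_par nx ny nz)[].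
have e1n : (e_ F 1 : 'rV_2) != 0 by have [] := not_par_neq0 (@e0_npar F 0).
have fam1 : exists U, forall x, f (tens x e0 e0) = tens (x *m U) (e0 *m V') w.
  have [|[v1 [w1 [U E]]]|[u1 [w1 [M E]]]|[u1 [v1 [M E]]]] := @linear_family _ _ _ _ _ (f \o slot1 e0 e0).
  - by move=> x nx; apply: f_fund; apply: (iffRL (fundamental_tens x e0 e0)).
  - have : tens u (e0 *m V') w = tens (e0 *m U) v1 w1 by rewrite -f2 -E.
    move/(tens_inj_par nu nv nw) => [_ /(par_scale nv)[l1 E1] /(par_scale nw)[l2 E2]].
    exists (l1 *: (l2 *: U)) => x.
    by rewrite -!scalemxAr !tens_scale1 -tens_scale3 -E2 -tens_scale2 -E1 -E.
  - have : tens u (e0 *m V') w = tens u1 (e0 *m M) w1 by rewrite -f2 -E.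
    move/(tens_inj_par nu nv nw) => [/(par_scale nu)[l1 E1] _ /(par_scale nw)[l2 E2]].
    have [] := H2 (e_ F 1) e0 e0 (l1 *: (l2 *: (e_ F 1 *m M))) e1n (n0 _) (n0 _).
      by rewrite !tens_scale2 -tens_scale3 -E2 -tens_scale1 -E1 -E.
    by move=> /par_sym /e0_npar.
  have : tens u (e0 *m V') w = tens u1 v1 (e0 *m M) by rewrite -f2 -E.
  move/(tens_inj_par nu nv nw) => [/(par_scale nu)[l1 E1] /(par_scale nv)[l2 E2] _].
  have := H3 (e_ F 1) e0 e0 (l1 *: (l2 *: (e_ F 1 *m M))) e1n (n0 _) (n0 _).
  by rewrite !tens_scale3 -tens_scale2 -E2 -tens_scale1 -E1 -E => /(_ erefl) /par_sym /e0_npar.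
have [U f1] := fam1.
have uU : U \in unitmx.
  apply: unitmx_of_inj => x nx.
  have /fundamental_tens[] : fundamental (tens (x *m U) (e0 *m V') w) => //.
  by rewrite -f1; apply/f_fund/fundamental_tens.
have eU : e0 *m U = u by apply: (tens_injl nv nw); rewrite -f1 f2.
exists U, V', W; split => //.
by apply: agree_act => // x; rewrite act_tens ?f1 ?f2 ?f3 ?eU ?eW.
Qed.

Lemma preserver_structure (f : {linear V -> V}) : injective f ->
  (forall t, fundamental t -> fundamental (f t)) ->
  exists U V' W, [/\ U \in unitmx, V' \in unitmx, W \in unitmx &
    (f =1 act U V' W) \/ (f =1 act U V' W \o @swap F 2 3)].
Proof.
move=> f_inj f_fund; have n0 n := @e0_neq0 F n.
have [|[v1 [w1 [M E]]]|[u1 [w1 [M E]]]|[u1 [v1 [M E]]]] := @linear_family _ _ _ _ _ (f \o slot2 e0 e0).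
- by move=> x nx; apply: f_fund; apply: (iffRL (fundamental_tens e0 x e0)).
- have [x [nx xM]] := wide_kernel M.
  have /fundamental_tens[] : fundamental (tens (x *m M) v1 w1).
    by rewrite -E; apply: f_fund; apply/fundamental_tens.
  by rewrite xM eqxx.
- have [U [V' [W [uU uV uW H]]]] := preserver_act f_inj f_fund E.
  by exists U, V', W; split => //; left.
(* Slot 2 goes to slot 3: following [f] by [swap] reduces to the previous case. *)
have [||x|U [V' [W [uU uV uW H]]]] := @preserver_act (@swap F 2 3 \o f) u1 v1 M.
- by apply: inj_comp f_inj; apply: can_inj (@swapK F 2 3).
- by move=> t /f_fund /swap_fundamental.
- by rewrite /= -[f _]/((f \o slot2 e0 e0) x) E swap_tens.
exists U, W, V'; split => //; right => t.
by rewrite /= -swap_act -[act _ _ _ _]H /= swapK.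
Qed.

End Normalisation.

Lemma stabG_structure (F : fieldType) (g : 'End(tensor F 2 3 3)) : stabG g ->
  exists U V' W, [/\ U \in unitmx, V' \in unitmx, W \in unitmx &
    (forall t, g t = act U V' W t) \/ (forall t, g t = act U V' W (swap t))].
Proof.
move=> [/lker0P g_inj gf]; apply: preserver_structure => // t ft.
by rewrite -gf; exists t.
Qed.

(** * Counting the orbits *)

Local Open Scope classical_set_scope.
Local Open Scope card_scope.
Local Open Scope ring_scope.

(** The bijection evaluates [f] at a chosen element of each orbit; [t0] is the default of [xget]. *)
Lemma card_orbits (T : choiceType) (orb : T -> set T) (f : T -> nat) n (t0 : T) :
  (forall t, orb t t) -> (forall t s, orb t s -> f t = f s) ->
  (forall t s, f t = f s -> orb t = orb s) ->
  (forall t, (f t < n)%N) -> (forall i, (i < n)%N -> exists t, f t = i) ->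
  range orb #= `I_n.
Proof.
move=> orbt forb orbf fn fsurj; apply/card_set_bijP.
have fget t : f (xget t0 (orb t)) = f t.
  by symmetry; apply: forb; apply: (xgetI _ (orbt t)).
exists (fun O => f (xget t0 O)); split.
- by move=> _ [t _ <-] /=; rewrite fget.
- by move=> _ _ /set_mem[t _ <-] /set_mem[s _ <-]; rewrite !fget; apply: orbf.
by move=> i /fsurj[t <-]; exists (orb t); [exists t | rewrite fget].
Qed.

(** * Tensors as pencils, orbits as classes *)

Section Slices.
Variable F : fieldType.
Local Notation V := (tensor F 2 3 3).

Definition slices (t : V) : pencil F :=
  (\matrix_(j, k) t (0, j, k), \matrix_(j, k) t (1, j, k)).

Definition tensor_of (p : pencil F) : V :=
  [ffun x => (if x.1.1 == 0 then p.1 else p.2) x.1.2 x.2].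

Lemma tensor_ofK p : slices (tensor_of p) = p.
Proof.
by case: p => A B; congr pair; apply/matrixP => j k; rewrite mxE ffunE.
Qed.

Lemma slicesK t : tensor_of (slices t) = t.
Proof.
apply/ffunP => -[[[[|[|i]] Hi] j] k] //; rewrite ffunE /= mxE;
 by congr (t (_, _, _)); apply: val_inj.
Qed.

Lemma slices_swap t : slices (swap t) = trp (slices t).
Proof. by congr pair; apply/matrixP => j k; rewrite !mxE ffunE. Qed.

(** Row vectors are acted on from the right, so the matrix of the second factor appears transposed
    on the left, and the columns of [U] give the coefficients mixing the slices. *)
Lemma slices_act U V' W t : slices (act U V' W t) =
  (V'^T *m comb (slices t) (U 0 0) (U 1 0) *m W, V'^T *m comb (slices t) (U 0 1) (U 1 1) *m W).
Proof.
have sum3 (G : 'I_2 * 'I_3 * 'I_3 -> F) : \sum_q G q = \sum_i \sum_j \sum_k G (i, j, k).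
  by rewrite pair_bigA pair_bigA /=; apply: eq_bigr => -[[? ?] ?].
have E i j k : act U V' W t (i, j, k) =
    (V'^T *m comb (slices t) (U 0 i) (U 1 i) *m W) j k.
  rewrite ffunE mxE; under [RHS]eq_bigr do rewrite mxE mulr_suml.
  rewrite [RHS]exchange_big /= sum3 big_ord_recl big_ord1 -big_split /=.
  apply: eq_bigr => j' _; rewrite -big_split /=; apply: eq_bigr => k' _.
  by rewrite !mxE (_ : lift ord0 ord0 = 1 :> 'I_2); [ring | apply: val_inj].
by congr pair; apply/matrixP => j k; rewrite mxE E.
Qed.

Lemma det2 (U : 'M[F]_2) : \det U = U 0 0 * U 1 1 - U 1 0 * U 0 1.
Proof.
rewrite (_ : U = m2 (U 0 0) (U 0 1) (U 1 0) (U 1 1)) ?det_m2 ?mxE /=; first by ring.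
by apply/matrixP => -[[|[|?]] ?] // [[|[|?]] ?] //; rewrite !mxE /=; congr (U _ _); apply: val_inj.
Qed.

Lemma act_peq U V' W t : U \in unitmx -> V' \in unitmx -> W \in unitmx ->
  peq (slices t) (slices (act U V' W t)).
Proof.
rewrite unitmxE unitfE det2 => uU uV uW.
exists (U 0 0), (U 1 0), (U 0 1), (U 1 1), V'^T, W.
by rewrite unitmx_tr slices_act.
Qed.

Lemma peq_act t s : peq (slices t) (slices s) -> exists U V' W,
  [/\ U \in unitmx, V' \in unitmx, W \in unitmx & s = act U V' W t].
Proof.
move=> [a [b [c [d [P [Q [nz uP uQ E]]]]]]].
exists (m2 a c b d), P^T, Q; rewrite unitmx_tr unitmxE unitfE det_m2 (mulrC c); split => //.
by apply: (can_inj slicesK); rewrite slices_act trmxK !mxE E.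
Qed.

Lemma orbitHP t s : tensor_orbit (@inducedH F 2 3 3) t s <-> peq (slices t) (slices s).
Proof.
split=> [[h /inducedHP[U [V' [W [uU uV uW H]]]] <-]|]; first by rewrite H; apply: act_peq.
move=> /peq_act[U [V' [W [uU uV uW ->]]]]; exists (linfun (act U V' W)); first exact: act_inducedH.
by rewrite lfunE.
Qed.

Lemma stabG_comp (g h : 'End(V)) : stabG g -> stabG h -> stabG (h \o g)%VF.
Proof.
move=> [/lker0P gi gf] [/lker0P hi hf]; split.
  by rewrite /GLV /=; apply/lker0P => s t; rewrite !lfunE /= => /hi/gi.
apply/seteqP; split=> t.
  move=> [s fs <-]; rewrite lfunE /= -hf; exists (g s) => //.
  by rewrite -gf; exists s.
rewrite -{1}hf => -[s]; rewrite -{1}gf => -[r fr <-] <-.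
by exists r => //; rewrite lfunE.
Qed.

Lemma orbitGP t s : tensor_orbit (@stabG F 2 3 3) t s <->
  peq (slices t) (slices s) \/ peq (trp (slices t)) (slices s).
Proof.
split=> [[g /stabG_structure[U [V' [W [uU uV uW [H|H]]]]] <-]|[]].
- by left; rewrite H; apply: act_peq.
- by right; rewrite H -slices_swap; apply: act_peq.
- by move=> /orbitHP[h /inducedH_sub_stabG Gh <-]; exists h.
rewrite -slices_swap => /orbitHP[h /inducedH_sub_stabG Gh <-].
exists (h \o linfun (@swap F 2 3))%VF; last by rewrite lfunE /= lfunE.
by apply: stabG_comp Gh; apply: swap_stabG.
Qed.

(* The three pairs of classes exchanged by transposition are i and i + 3, for i = 4, 5, 6. *)
Definition merge_idx i := if (i < 7)%N then i else (i - 3)%N.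

Lemma merge_idx_swap i : merge_idx (swap_idx i) = merge_idx i.
Proof. by move: i => [|[|[|[|[|[|[|[|[|[|i]]]]]]]]]]; rewrite /swap_idx /= ?nth_nil. Qed.

Lemma merge_idx_eq i j : merge_idx i = merge_idx j -> i = j \/ swap_idx i = j.
Proof.
by move: i j => [|[|[|[|[|[|[|[|[|[|i]]]]]]]]]] [|[|[|[|[|[|[|[|[|[|j]]]]]]]]]];
  rewrite /merge_idx /swap_idx /= ?subSS ?subn0 ?nth_nil => E; try discriminate E; auto;
  left; congr _.+3; apply: E.
Qed.

Lemma count_orbits N (a b c d : F) M : complete N a b c d M -> (10 <= N)%N ->
  tensor_orbits (@inducedH F 2 3 3) #= `I_N /\
  tensor_orbits (@stabG F 2 3 3) #= `I_(N - 3).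
Proof.
move=> [C1 C2] N10.
have peqE (p q : pencil F) : idx p = idx q -> peq p q.
  move=> E; have [_ pr] := C1 p; have [_ qr] := C1 q.
  by apply: peq_trans pr _; rewrite E; apply: peq_sym.
split.
  apply: (@card_orbits _ _ (fun t => idx (slices t)) _ 0).
  - by move=> t; apply/orbitHP; apply: peq_refl.
  - by move=> t s /orbitHP; apply: idx_peq.
  - move=> t s /peqE ts; apply/seteqP; split=> r /orbitHP tr; apply/orbitHP.
      exact: peq_trans (peq_sym ts) tr.
    exact: peq_trans ts tr.
  - by move=> t; case: (C1 (slices t)).
  by move=> i iN; exists (tensor_of (rep a b c d M i)); rewrite tensor_ofK C2.
apply: (@card_orbits _ _ (fun t => merge_idx (idx (slices t))) _ 0).
- by move=> t; apply/orbitGP; left; apply: peq_refl.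
- by move=> t s /orbitGP[|] /idx_peq <- //; rewrite idx_trp merge_idx_swap.
- move=> t s /merge_idx_eq[/peqE ts|]; last rewrite -idx_trp => /peqE ts.
    apply/seteqP; split=> r /orbitGP[] tr; apply/orbitGP; [left|right|left|right].
    + exact: peq_trans (peq_sym ts) tr.
    + exact: peq_trans (peq_sym (peq_trp ts)) tr.
    + exact: peq_trans ts tr.
    + exact: peq_trans (peq_trp ts) tr.
  (* Here the slices of [s] are equivalent to the transposed slices of [t], so the two alternatives
     of [orbitGP] trade places. *)
  have st := peq_trp ts; rewrite trpK in st.
  apply/seteqP; split=> r /orbitGP[] tr; apply/orbitGP; [right|left|right|left].
  + exact: peq_trans (peq_sym st) tr.
  + exact: peq_trans (peq_sym ts) tr.
  + exact: peq_trans ts tr.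
  + exact: peq_trans st tr.
- move=> t; case: (C1 (slices t)) => iN _; rewrite /merge_idx; case: ifP => i7.
    by rewrite (leq_trans i7) // leq_subRL // (leq_trans _ N10).
  by rewrite ltn_sub2r // (leq_trans _ N10).
(* A merged index below 7 is represented by the class of the same number, any other [i] by the class
   i + 3. *)
move=> i iN; have iN3 : (i + 3 < N)%N by rewrite addnC -ltn_subRL.
have [i7|i7] := ltnP i 7.
  exists (tensor_of (rep a b c d M i)); rewrite tensor_ofK C2 /merge_idx ?i7 //.
  by apply: leq_ltn_trans iN3; apply: leq_addr.
exists (tensor_of (rep a b c d M (i + 3)%N)); rewrite tensor_ofK C2 // /merge_idx ifF ?addnK //.
by apply/negbTE; rewrite -leqNgt (leq_trans i7) // leq_addr.
Qed.

End Slices.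

Theorem mainTheorem1 :
  [/\ forall F : finFieldType,
        tensor_orbits (@inducedH F 2 3 3) #= `I_21 /\
        tensor_orbits (@stabG F 2 3 3) #= `I_18,
      forall F : closedFieldType,
        tensor_orbits (@inducedH F 2 3 3) #= `I_18 /\
        tensor_orbits (@stabG F 2 3 3) #= `I_15
    & forall R : realType,
        tensor_orbits (@inducedH R 2 3 3) #= `I_20 /\
        tensor_orbits (@stabG R 2 3 3) #= `I_17].
Proof.
split=> [F|F|R].
- have [a [b [c [d [M C]]]]] := finite_complete F; exact: count_orbits C _.
- exact: count_orbits (closed_complete F) _.
exact: count_orbits (real_complete R) _.
Qed.
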